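(* Let $W\in\mathcal{C}^1(\mathbb{R}^n,\mathbb{R})$ be positive definite and assume that: 1. there exist $C_0>0$ and $m\in(1,\infty)$ such that the function $F_W(x):=C_0\left|\frac{\partial W}{\partial x_n}(x)\right|^m-\nabla W(x)^\top J_nx$ is positive definite; 2. there exist $\alpha_1,\alpha_2,d>0$ and $\mu\in\left(0,\frac{d}{mn}\right)$ such that $$\alpha_1\sum_{i=1}^n|x_i|^{\frac d{r_i}}\le F_W(x)\le\alpha_2\sum_{i=1}^n|x_i|^{\frac d{r_i}},\qquad\forall x\in\mathbb{R}^n,$$ where $r_i:=\frac{d(m-1)}{m}+(n-i+1)\mu$ for $1\le i\le n$. Then the feedback control $u_W(x)=-C_0\left\lfloor\frac{\partial W}{\partial x_n}(x)\right\rceil^{m-1}$ induces finite-time convergence for $\dot x=J_nx+e_nu$. If, moreover, $F_W$ is continuously differentiable, convex and homogeneous of degree $d$ with respect to $(\delta^r_\epsilon)_{\epsilon>0}$, then the feedback control $\tilde u_W(x)=-mC_0\left\lfloor\frac{\partial W}{\partial x_n}(x)\right\rceil^{m-1}$ solves $(OCP)_\infty$ with $F=(mC_0)^{\frac1{m-1}}F_W$ and $q=\frac m{m-1}$, and induces finite-time convergence.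
   Context: Let $n\ge1$ be an integer, $J_n$ the $n\times n$ Jordan block with eigenvalue $0$ (ones on the superdiagonal, zeros elsewhere) and $e_n$ the last canonical basis vector of $\mathbb{R}^n$. A function $f:\mathbb{R}^n\to\mathbb{R}$ is positive definite if $f(0)=0$ and $f(x)>0$ for $x\ne0$. For $a\in\mathbb{R}$ and $s>0$, $\lfloor a\rceil^s=|a|^s\,\mathrm{sgn}(a)$. For $r=(r_1,\dots,r_n)$ with positive entries and $\epsilon>0$, $\delta^r_\epsilon(x)=(\epsilon^{r_1}x_1,\dots,\epsilon^{r_n}x_n)$; $f$ is homogeneous of degree $d$ with respect to $(\delta^r_\epsilon)_{\epsilon>0}$ if $f(\delta^r_\epsilon(x))=\epsilon^df(x)$ for all $\epsilon>0$ and $x\in\mathbb{R}^n$. A continuous feedback $u(x)$ induces finite-time convergence if every (maximal) solution of $\dot x=J_nx+e_nu(x)$, from any initial condition, reaches the origin in finite time and stays there. For $q\in(1,\infty)$ and $F:\mathbb{R}^n\to\mathbb{R}_{\ge0}$ continuously differentiable, convex and positive definite, $(OCP)_\infty$ is the problem of minimizing $\int_0^\infty\left(\frac{|u(t)|^q}{q}+F(x(t))\right)dt$ over $u\in L^q(\mathbb{R}_{\ge0},\mathbb{R})$, where $\dot x=J_nx+e_nu$, $x(0)=x_0$; for every $x_0$ it has a unique minimizer. A feedback $\tilde u(x)$ solves $(OCP)_\infty$ if for every $x_0$ the optimal control $u$ and optimal trajectory $x$ from $x_0$ satisfy $u(t)=\tilde u(x(t))$ for almost every $t\ge0$. *)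

(* Defs.v *)
From mathcomp Require Import all_boot all_order all_algebra.
From mathcomp Require Import all_classical all_reals all_analysis.

Set Implicit Arguments.
Unset Strict Implicit.
Unset Printing Implicit Defensive.

Import Order.TTheory GRing.Theory Num.Theory.
Import numFieldNormedType.Exports.

Local Open Scope classical_set_scope.
Local Open Scope ring_scope.

Section Functions.
Context {R : realType} {n : nat}.
Implicit Types (f : 'cV[R]_n -> R) (x y : 'cV[R]_n).

Definition jordan0 : 'M[R]_n := \matrix_(i, j) (j == i.+1 :> nat)%:R.

(* Rows are numbered from 0, so the last one is i with i + 1 = n. *)
Definition e_last : 'cV[R]_n := \col_i (i.+1 == n)%:R.

Definition pos_def f : Prop := f 0 = 0 /\ forall x, x != 0 -> 0 < f x.

(* In finite dimension, continuity of x |-> 'd f x amounts to continuity of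
   x |-> 'd f x v for every vector v. *)
Definition cont_diff f : Prop :=
  (forall x, differentiable f x) /\
  (forall v : 'cV[R]_n, continuous (fun x => 'D_v f x)).

Definition grad f x : 'cV[R]_n := \col_i 'D_(delta_mx i 0) f x.

Definition convex_fun f : Prop :=
  convex_function (setT : set (convex_lmodType 'cV[R]_n)) f.

Definition dilation (r : 'I_n -> R) (eps : R) x : 'cV[R]_n :=
  \col_i (eps `^ r i * x i 0).

Definition homogeneous (r : 'I_n -> R) (d : R) f : Prop :=
  forall (eps : R) x, 0 < eps -> f (dilation r eps x) = eps `^ d * f x.

End Functions.

Definition sgn_pow {R : realType} (a s : R) : R := `|a| `^ s * Num.sg a.

Section FiniteTime.
Context {R : realType} {n : nat}.
Implicit Types (u : 'cV[R]_n -> R) (T : \bar R) (x : R -> 'cV[R]_n).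

(* Classical solutions of x' = J_n x + e_n u(x) on [0, T), 0 < T <= +oo; the
   values of x outside [0, T) are irrelevant. For a continuous u, continuity
   at 0 together with the equation on (0, T) gives the right derivative at 0. *)
Definition feedback_solution u T x : Prop :=
  [/\ (0 < T)%E,
      {within [set t | 0 <= t /\ (t%:E < T)%E], continuous x} &
      forall t : R, 0 < t -> (t%:E < T)%E ->
        is_derive t 1 x (jordan0 *m x t + u (x t) *: e_last)].

Definition maximal_solution u T x : Prop :=
  feedback_solution u T x /\
  forall T' x', feedback_solution u T' x' ->
    (forall t : R, 0 <= t -> (t%:E < T)%E -> x' t = x t) -> (T' <= T)%E.

Definition finite_time_convergence u : Prop :=
  continuous u /\
  forall T x, maximal_solution u T x ->
    T = +oo%E /\ exists2 t0 : R, 0 <= t0 & forall t, t0 <= t -> x t = 0.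

End FiniteTime.

Section OptimalControl.
Context {R : realType} {n : nat}.
Local Notation mu := (@lebesgue_measure R).
Implicit Types (q : R) (F : 'cV[R]_n -> R) (v : R -> R) (x : R -> 'cV[R]_n).

Definition Lq_control q v : Prop :=
  measurable_fun (`[0, +oo[ : set R) v /\
  (\int[mu]_(t in `[0%R, +oo[) (`|v t| `^ q)%:E < +oo)%E.

(* Caratheodory solution on [0, +oo) of x' = J_n x + e_n v, x(0) = x0, in
   integral form. *)
Definition trajectory (x0 : 'cV[R]_n) v x : Prop :=
  {within `[0, +oo[, continuous x} /\
  forall (t : R) (i : 'I_n), 0 <= t ->
    x t i 0 = x0 i 0 +
      \int[mu]_(s in `[0, t]) ((jordan0 *m x s + v s *: e_last) i 0).

Definition cost q F v x : \bar R :=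
  (\int[mu]_(t in `[0%R, +oo[) (`|v t| `^ q / q + F (x t))%:E)%E.

Definition optimal_pair q F (x0 : 'cV[R]_n) v x : Prop :=
  [/\ Lq_control q v, trajectory x0 v x &
      forall w y, Lq_control q w -> trajectory x0 w y ->
        (cost q F v x <= cost q F w y)%E].

(* The first two clauses say that "the optimal control" exists and is unique
   as an element of L^q([0, +oo)). *)
Definition solves_OCP q F (u : 'cV[R]_n -> R) : Prop :=
  forall x0 : 'cV[R]_n, exists v x,
    [/\ optimal_pair q F x0 v x,
        forall w y, optimal_pair q F x0 w y ->
          {ae mu, forall t, 0 <= t -> w t = v t} &
        {ae mu, forall t, 0 <= t -> v t = u (x t)}].

End OptimalControl.

Section LyapunovData.
Context {R : realType} {n : nat}.

Definition F_of (W : 'cV[R]_n -> R) (C0 m : R) (x : 'cV[R]_n) : R :=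
  C0 * `|'D_e_last W x| `^ m - ((grad W x)^T *m (jordan0 *m x)) 0 0.

(* r_i = d (m - 1) / m + (n - i + 1) mu for i = 1, ..., n; here i starts at 0. *)
Definition weight (d m mu : R) (i : 'I_n) : R :=
  d * (m - 1) / m + (n - i)%:R * mu.

End LyapunovData.

(* Main.v *)
(* Along the closed loop of gain k >= C0 one has
   dW/dt = - F_W - (k - C0) |W_n|^m, where W_n is the last partial derivative.
   For k = m C0 this also dissipates the input, and a solution on [0, 1] bounds
   |x(0)| by W(x(0)): W is coercive. Conversely, Young's inequality
   gives c dW/dt >= - c F_W - |u|^q / q along every controlled trajectory, with
   c = (m C0)^(1/(m-1)); steering x to the origin in time e^mu by a dilated
   Hermite polynomial, where |x_i| <= e^(r_i), yields W(x) <= K e^(d + mu). Hence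
   dW/dt <= - a W^(d/(d+mu)) and W vanishes in finite time; coercivity and
   Peano's theorem exclude a finite maximal time of existence.
   Young's inequality integrated along a trajectory shows that every cost is at
   least c W(x0), and it is an equality for the feedback of gain m C0, which is
   therefore optimal; the optimal control is unique because F is convex and
   |u|^q strictly convex. *)
Require Import Defs.
From mathcomp Require Import all_boot all_order all_algebra.
From mathcomp Require Import all_classical all_reals all_analysis.
From mathcomp Require Import measurable_realfun ring lra.

Set Implicit Arguments.
Unset Strict Implicit.
Unset Printing Implicit Defensive.

Import Order.TTheory GRing.Theory Num.Theory.
Import numFieldNormedType.Exports.

Local Open Scope classical_set_scope.
Local Open Scope ring_scope.

(** * Real calculus and signed powers *)

(** The weights drop by mu along the chain, so the integrators scale with the time unit e^mu, and
    the weight left for the input is d (m - 1) / m = d / q: |u|^q and F_W both scale like e^d. Hence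
    steering costs e^d per unit time during e^mu, which produces the exponent d / (d + mu) < 1. The
    smallness of mu keeps every r_i below d, so that F_W dominates the state linearly up to a
    constant; coercivity rests on this. Three obstacles shape the rest. The feedback is merely
    continuous, so solutions may fail to be unique, and finite time is derived for each of them from
    the decay of W. Controlled trajectories are only absolutely continuous, so W cannot simply be
    differentiated along them: it is compared with the cost on short intervals, the gradient being
    frozen on each. Finally the comparison on [0, T] leaves a term c W(x(T)); it is removed because
    a trajectory on which W stays away from 0 has infinite cost. *)

Section RealCalculus.
Context {R : realType}.
Implicit Types (g dg : R -> R) (a b s t : R).

Lemma derive_le0_le g dg a b : a <= b -> {within `[a, b], continuous g} ->
  (forall t, a < t -> t < b -> is_derive t 1 g (dg t)) ->
  (forall t, a < t -> t < b -> dg t <= 0) -> g b <= g a.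
Proof.
move=> ab cg dgE dg0.
have {}dgE t : t \in `]a, b[ -> is_derive t 1 g (dg t).
  by rewrite in_itv/= => /andP[]; exact: dgE.
move: ab; rewrite le_eqVlt => /predU1P[->//|ab].
have [c + E] := MVT ab dgE cg; rewrite in_itv/= => /andP[ac cb].
by rewrite -subr_le0 E mulr_le0_ge0 ?dg0// subr_ge0 ltW.
Qed.

Lemma derive_norm_le g dg a b (L : R) : a <= b ->
  {within `[a, b], continuous g} ->
  (forall t, a < t -> t < b -> is_derive t 1 g (dg t)) ->
  (forall t, a < t -> t < b -> `|dg t| <= L) -> `|g b - g a| <= L * (b - a).
Proof.
move=> ab cg dgE dgL.
have {}dgE t : t \in `]a, b[ -> is_derive t 1 g (dg t).
  by rewrite in_itv/= => /andP[]; exact: dgE.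
move: ab; rewrite le_eqVlt => /predU1P[->|ab]; first by rewrite !subrr normr0 mulr0.
have [c + E] := MVT ab dgE cg; rewrite in_itv/= => /andP[ac cb].
rewrite E normrM (gtr0_norm (_ : 0 < b - a)) ?subr_gt0//.
by rewrite ler_wpM2r ?dgL// subr_ge0 ltW.
Qed.

(** Shaped for the auxiliary function of [ode_solution_tradeoff]. *)
Lemma is_derive_affine_mul (f g : R -> R) (t df dg a b c : R) :
  is_derive t 1 f df -> is_derive t 1 g dg ->
  is_derive t 1 (fun s => f s + (a + b * s) * g s + c * s)
    (df + ((a + b * t) * dg + b * g t) + c).
Proof.
move=> fd gd.
have ld k l : is_derive t (1 : R) (fun s => k + l * s) l.
  rewrite (_ : (fun s => k + l * s) = cst k + l \*: id); last exact/funext.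
  by apply: is_derive_eq; rewrite add0r [LHS]mulr1.
have -> : (fun s => f s + (a + b * s) * g s + c * s) =
    f + (fun s => a + b * s) * g + (fun s => 0 + c * s).
  by apply/funext => s; rewrite !fctE add0r.
apply: is_derive_eq; congr (_ + _ + _); rewrite mulrC.
by congr (_ + _); exact: mulrC.
Qed.

End RealCalculus.

Section SgnPow.
Context {R : realType}.
Implicit Types a b s t : R.

Lemma le_add1_powR a s : 0 <= a -> 1 <= s -> a <= 1 + a `^ s.
Proof.
move=> a0 s1; have [a1|/ltW a1] := leP 1 a.
  by rewrite (le_trans (le1r_powR a1 s1))// lerDr.
by rewrite (le_trans a1)// lerDl powR_ge0.
Qed.

Lemma norm_sgn_pow a s : s != 0 -> `|sgn_pow a s| = `|a| `^ s.
Proof.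
move=> s0; rewrite /sgn_pow normrM normr_sg ger0_norm ?powR_ge0//.
by have [->|a0] := eqVneq a 0; rewrite ?normr0 ?powR0 ?mul0r//= ?mulr1.
Qed.

Lemma sgn_pow0 s : sgn_pow 0 s = 0 :> R.
Proof. by rewrite /sgn_pow sgr0 mulr0. Qed.

Lemma sgn_powM a m : 1 < m -> a * sgn_pow a (m - 1) = `|a| `^ m.
Proof.
move=> m1; rewrite /sgn_pow mulrCA (mulrC a) -normrEsg mulrC mulr_powRB1//.
exact: lt_trans ltr01 m1.
Qed.

Lemma continuous_norm_powR s : 0 < s -> continuous (fun a : R => `|a| `^ s).
Proof.
move=> s0 a; have [->|a0] := eqVneq a 0; last first.
  apply: (@continuous_comp _ _ _ (fun a => `|a|) (fun b => b `^ s)).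
    exact: norm_continuous.
  apply/differentiable_continuous/derivable1_diffP/derivable_powR.
  by rewrite in_itv/= andbT normr_gt0.
rewrite /continuous_at normr0 powR0 ?gt_eqF//.
apply/cvgrPdist_lt => e e0; near=> b.
rewrite sub0r normrN ger0_norm ?powR_ge0//.
have -> : e = (e `^ s^-1) `^ s by rewrite -powRrM mulVf ?gt_eqF// powRr1 ?ltW.
rewrite gt0_ltr_powR ?nnegrE ?powR_ge0 ?normr_ge0//.
near: b; apply/nbhs_ballP; exists (e `^ s^-1) => /=; first exact: powR_gt0.
by move=> b; rewrite /ball/= sub0r normrN.
Unshelve. all: by end_near. Qed.

Lemma continuous_sgn_pow s : 0 < s -> continuous (fun a : R => sgn_pow a s).
Proof.
move=> s0 a; have [->|a0] := eqVneq a 0; last first.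
  apply: (@cvgM _ _ _ _ (fun a : R => `|a| `^ s) (fun a : R => Num.sg a)).
    exact: continuous_norm_powR.
  apply: (@near_cst_continuous _ _ (Num.sg a)).
  case: (ltgtP a 0) a0 => // [a_lt0|a_gt0] _; near=> b.
    rewrite !ltr0_sg//; near: b; exact: lt_nbhsl.
  rewrite !gtr0_sg//; near: b; exact: lt_nbhsr.
rewrite /continuous_at sgn_pow0.
apply/norm_cvg0P; under eq_cvg do rewrite norm_sgn_pow ?gt_eqF//.
have := @continuous_norm_powR s s0 0.
by rewrite /continuous_at normr0 powR0 ?gt_eqF.
Unshelve. all: by end_near. Qed.

(* Young's inequality, scaled so that the factor of [`|a| `^ m] is [c * C0];
   it is sharp at the feedback value [v = - (m * C0) * sgn_pow a (m - 1)]. *)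
Lemma young_scaled (C0 m a v : R) : 0 < C0 -> 1 < m ->
  let c := (m * C0) `^ (1 / (m - 1)) in let q := m / (m - 1) in
  - (c * (a * v)) <= `|v| `^ q / q + c * (C0 * `|a| `^ m).
Proof.
move=> C00 m1 /=; set c := (m * C0) `^ _; set q := m / (m - 1).
have m0 : 0 < m by exact: lt_trans ltr01 m1.
have m10 : 0 < m - 1 by rewrite subr_gt0.
have q0 : 0 < q by rewrite divr_gt0.
have c0 : 0 <= c by exact: powR_ge0.
(* This identity dictates the exponent in [c]: it turns (c |a|)^m / m into c C0 |a|^m. *)
have cm : c `^ m = (m * C0) * c.
  rewrite -[X in X * c]powRr1 ?mulr_ge0 ?ltW// -powRD; last first.
    by apply/implyP => _; rewrite gt_eqF // mulr_gt0.
  by rewrite /c -powRrM; congr (_ `^ _); field; rewrite gt_eqF.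
have := @conjugate_powR _ `|v| (c * `|a|) q m.
rewrite normr_ge0 mulr_ge0// => /(_ isT isT q0 m0) H.
have {}H : `|v| * (c * `|a|) <= `|v| `^ q / q + c * (C0 * `|a| `^ m).
  have -> : c * (C0 * `|a| `^ m) = (c * `|a|) `^ m / m.
    by rewrite powRM// cm; field; rewrite gt_eqF.
  by apply: H; rewrite /q; field; rewrite !gt_eqF.
apply: le_trans H; rewrite (le_trans (ler_norm _))// normrN !normrM (ger0_norm c0).
by rewrite (_ : c * (`|a| * `|v|) = `|v| * (c * `|a|))//; ring.
Qed.

(** Here |v|^q = m C0 c |a|^m = (c |a|)^m, the equality case of Young's inequality, and [v] has the
    sign opposite to [a]. *)
Lemma young_scaled_eq (C0 m a : R) : 0 < C0 -> 1 < m ->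
  let c := (m * C0) `^ (1 / (m - 1)) in let q := m / (m - 1) in
  let v := - (m * C0) * sgn_pow a (m - 1) in
  `|v| `^ q / q + c * (C0 * `|a| `^ m) = - (c * (a * v)).
Proof.
move=> C00 m1 /=; set c := (m * C0) `^ _; set q := m / (m - 1).
set v := - (m * C0) * _.
have m0 : 0 < m by exact: lt_trans ltr01 m1.
have m10 : 0 < m - 1 by rewrite subr_gt0.
have mC : 0 < m * C0 by rewrite mulr_gt0.
have -> : a * v = - (m * C0) * `|a| `^ m by rewrite /v mulrCA sgn_powM.
rewrite /v normrM normrN (gtr0_norm mC) norm_sgn_pow ?gt_eqF//.
rewrite powRM ?powR_ge0 ?(ltW mC)// -powRrM (_ : (m - 1) * q = m); last first.
  by rewrite /q; field; rewrite gt_eqF.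
have -> : (m * C0) `^ q = (m * C0) * c.
  rewrite -[X in X * c](powRr1 (ltW mC)) /c -powRD ?(gt_eqF mC) ?implybT//.
  by congr (_ `^ _); rewrite /q; field; rewrite gt_eqF.
by rewrite /q; field; rewrite !gt_eqF.
Qed.

End SgnPow.


(** * Peano's existence theorem *)

Section ColumnVectors.
Context {R : realType} {n : nat}.
Implicit Types (x y : 'cV[R]_n) (B : R).

Lemma norm_cV_le x B : 0 <= B -> (forall i, `|x i 0| <= B) -> `|x| <= B.
Proof.
move=> B0 xB; rewrite [leLHS]/Num.Def.normr/= mx_normrE bigmax_le//= => -[i j] _.
by rewrite ord1.
Qed.

Lemma norm_cV_ge x i : `|x i 0| <= `|x|.
Proof.
rewrite [leRHS]/Num.Def.normr/= mx_normrE.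
exact: (le_bigmax _ (fun ij : 'I_n * 'I_1 => `|x ij.1 ij.2|) (i, 0)).
Qed.

Lemma norm_cV_lt x B : 0 < B -> (forall i, `|x i 0| < B) -> `|x| < B.
Proof.
move=> B0 xB; rewrite [ltLHS]/Num.Def.normr/= mx_normrE bigmax_lt//= => -[i j] _.
by rewrite ord1.
Qed.

Lemma cvg_cV {T : Type} (F : set_system T) {FF : Filter F} (u : T -> 'cV[R]_n) y :
  (forall i, u t i 0 @[t --> F] --> y i 0) -> u @ F --> y.
Proof.
move=> uy; apply/cvgrPdist_lt => e e0; near=> t.
apply: norm_cV_lt => // i; rewrite !mxE; move: i; near: t.
by apply: filter_forall => i; exact: ((cvgrPdist_lt _ _).1 (uy i)).
Unshelve. all: by end_near. Qed.

Lemma is_derive_cVP (x : R -> 'cV[R]_n) (t : R) y :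
  is_derive t 1 x y <-> forall i, is_derive t 1 (fun s => x s i 0) (y i 0).
Proof.
split=> [[dx <-] i|dx].
  apply: DeriveDef; first exact: (derivable_mxP _ _ _).1.
  by rewrite derive_mx// mxE.
have dxt : derivable x t 1.
  by apply/derivable_mxP => i j; rewrite ord1; exact: (dx i).(ex_derive).
apply: DeriveDef => //; rewrite derive_mx//; apply/matrixP => i j.
by rewrite ord1 mxE (dx i).(derive_val).
Qed.

Lemma ultra_fmap {T V : Type} (f : T -> V) (U : set_system T) :
  UltraFilter U -> UltraFilter (f @ U).
Proof.
move=> UU; split; first exact: fmap_proper_filter.
move=> G GF UG; rewrite predeqE => A; split; last exact: UG.
move=> GA; have [//|UA] := in_ultra_setVsetC (f @^-1` A) UU.
by have /filter_ex[? []] : G (A `&` ~` A) by apply: filterI => //; exact: UG.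
Qed.

(** Bolzano-Weierstrass in ultrafilter form: each coordinate lives in a compact segment. It replaces
    the extraction of subsequences. *)
Lemma ultra_bounded_cvg {T : Type} (U : set_system T) (u : T -> 'cV[R]_n) B :
  UltraFilter U -> (forall k, `|u k| <= B) -> exists l : 'cV[R]_n, u @ U --> l.
Proof.
move=> UU uB.
have cvgi i : exists l : R, u k i 0 @[k --> U] --> l.
  have := @segment_compact R (- B) B; rewrite compact_ultra => /(_ (u k i 0 @[k --> U])).
  have UI : UltraFilter (u k i 0 @[k --> U]) by exact: ultra_fmap.
  have Uset : (u k i 0 @[k --> U]) `[- B, B]%classic.
    rewrite /fmap/=; apply: filterE => k; rewrite /= in_itv/= -ler_norml.
    exact: le_trans (norm_cV_ge _ _) (uB k).
  by move=> /(_ UI Uset)[l [_ ?]]; exists l.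
pose l i := sval (cid (cvgi i)).
exists (\col_i l i); apply: cvg_cV => i; rewrite mxE /l.
exact: (svalP (cid (cvgi i))).
Qed.

(** Otherwise points of the ball with |f| > k for each k would converge along an ultrafilter, and
    continuity at the limit bounds |f| there. *)
Lemma bounded_image_ball {V : normedModType R} (f : 'cV[R]_n -> V) B :
  continuous f -> exists2 L, 0 <= L & forall x, `|x| <= B -> `|f x| <= L.
Proof.
move=> cf; apply: contrapT => nL.
have ux k : {x | `|x| <= B /\ k%:R < `|f x|}.
  apply: cid; apply: contrapT => H; apply: nL; exists k%:R => // x xB.
  by rewrite leNgt; apply/negP => ?; apply: H; exists x.
have [U [UU ooU]] := ultraFilterLemma eventually_filter.
pose u k := sval (ux k).
have uB k : `|u k| <= B by have [] := svalP (ux k).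
have [l ul] := ultra_bounded_cvg UU uB.
have /cvgrPdist_lt/(_ 1 ltr01) fu : f (u k) @[k --> U] --> f l.
  exact: (cvg_comp u f ul (cf l)).
have [K /= lK] : exists K : nat, `|f l| + 1 <= K%:R.
  by exists (Num.truncn (`|f l| + 1)).+1; rewrite ltW// truncnS_gt.
have [k [/= fk Kk]] : exists k, `|f l - f (u k)| < 1 /\ (K <= k)%N.
  have /filter_ex[k [? ?]] : U ([set k | `|f l - f (u k)| < 1] `&` [set k | (K <= k)%N]).
    by apply: filterI => //; apply: ooU; exists K.
  by exists k.
have [_] := svalP (ux k); rewrite -/(u k) ltNge => /negP; apply.
rewrite (le_trans (_ : _ <= `|f l| + 1))//.
  by rewrite -lerBlDl (le_trans (lerB_dist _ _))// distrC ltW.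
by rewrite (le_trans lK)// ler_nat.
Qed.

(** Limits of Euler schemes and glued solutions come with such first-order estimates rather than
    with difference quotients. *)
Lemma is_derive_littleo {V : normedModType R} (x : R -> V) (s : R) (y : V) :
  (forall e : R, 0 < e ->
    exists2 d : R, 0 < d & forall t, `|t - s| < d ->
      `|x t - x s - (t - s) *: y| <= e * `|t - s|) ->
  is_derive s 1 x y.
Proof.
move=> xy.
have dxy : h^-1 *: (x (h *: 1 + s) - x s) @[h --> 0^'] --> y.
  apply/cvgrPdist_le => e e0; have [d d0 H] := xy e e0.
  near=> h.
  have h0 : h != 0 by near: h; exact: nbhs_dnbhs_neq.
  rewrite -(@ler_pM2l _ `|h|) ?normr_gt0// -normrZ scalerBr scalerA divff//.
  rewrite scale1r distrC mulrC [h *: 1]mulr1.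
  by have := H (h + s); rewrite addrK; apply; near: h; exact: dnbhs0_lt.
apply: DeriveDef; first by apply/cvg_ex; exists y.
exact: cvg_lim.
Unshelve. all: by end_near. Qed.

End ColumnVectors.

Section Peano.
Context {R : realType} {n : nat}.
Variables (F : 'cV[R]_n -> 'cV[R]_n) (L : R).
Hypothesis FL : forall x, `|F x| <= L.

Fixpoint euler (h : R) (x0 : 'cV[R]_n) (j : nat) : 'cV[R]_n :=
  if j is k.+1 then euler h x0 k + h *: F (euler h x0 k) else x0.

Lemma euler_lipschitz h x0 j l : 0 <= h -> (j <= l)%N ->
  `|euler h x0 l - euler h x0 j| <= (l%:R - j%:R) * h * L.
Proof.
move=> h0; elim: l => [|l IH]; first by rewrite leqn0 => /eqP->; rewrite !subrr normr0 !mul0r.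
rewrite leq_eqVlt => /predU1P[->|]; first by rewrite !subrr normr0 !mul0r.
rewrite ltnS => /IH H /=; rewrite addrAC (le_trans (ler_normD _ _))//.
rewrite (_ : _ * L = (l%:R - j%:R) * h * L + h * L); last first.
  by rewrite -natr1; ring.
by rewrite lerD// normrZ ger0_norm// ler_wpM2l.
Qed.

(** Each step deviates from [h *: y] by at most [h * e], and the deviations add up. This becomes the
    derivative of the limit. *)
Lemma euler_affine h x0 j l y e : 0 <= h -> 0 <= e -> (j <= l)%N ->
  (forall r, (j <= r < l)%N -> `|F (euler h x0 r) - y| <= e) ->
  `|euler h x0 l - euler h x0 j - ((l%:R - j%:R) * h) *: y| <=
    (l%:R - j%:R) * h * e.
Proof.
move=> h0 e0; elim: l => [|l IH].
  by rewrite leqn0 => /eqP-> _; rewrite !subrr !mul0r scale0r subr0 normr0.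
rewrite leq_eqVlt => /predU1P[->|].
  by rewrite !subrr !mul0r scale0r subr0 normr0.
rewrite ltnS => jl Fe; have {}IH := IH jl.
have {}IH : `|euler h x0 l - euler h x0 j - ((l%:R - j%:R) * h) *: y| <=
    (l%:R - j%:R) * h * e.
  by apply: IH => r /andP[jr rl]; apply: Fe; rewrite jr ltnS ltnW.
rewrite (_ : _ - _ = (euler h x0 l - euler h x0 j - ((l%:R - j%:R) * h) *: y) +
   h *: (F (euler h x0 l) - y)); last first.
  rewrite /= -natr1 scalerBr.
  rewrite (_ : (_ + _ - _) * h = (l%:R - j%:R) * h + h); last by ring.
  rewrite scalerDl opprD !addrA.
  by rewrite (addrAC (euler h x0 l) (h *: F _)) (addrAC (_ - _) (h *: F _)).
rewrite (le_trans (ler_normD _ _))//.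
rewrite (_ : (l.+1%:R - _) * h * e = (l%:R - j%:R) * h * e + h * e); last first.
  by rewrite -natr1; ring.
by rewrite lerD// normrZ ger0_norm// ler_wpM2l// Fe// jl ltnSn.
Qed.

End Peano.

Section PeanoLimit.
Context {R : realType} {n : nat}.
Variables (F : 'cV[R]_n -> 'cV[R]_n) (L : R) (x0 : 'cV[R]_n).
Hypotheses (cF : continuous F) (L0 : 0 <= L) (FL : forall x, `|F x| <= L).

Let h (k : nat) : R := k.+1%:R^-1.
Let idx (k : nat) (t : R) := Num.truncn (t * k.+1%:R).
(** A step function, without interpolation between nodes: its jumps account for the extra [h k] in
    [X_lip], which vanishes in the limit. *)
Let X (k : nat) (t : R) := euler F (h k) x0 (idx k t).

Let h_gt0 k : 0 < h k. Proof. by rewrite invr_gt0 ltr0n. Qed.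

Let idx_le k (s t : R) : 0 <= s -> s <= t -> (idx k s <= idx k t)%N.
Proof. by move=> s0 st; apply: le_truncn; rewrite ler_wpM2r// ler0n. Qed.

Let idx_dist k (s t : R) : 0 <= s -> s <= t ->
  `|((idx k t)%:R - (idx k s)%:R) * h k - (t - s)| <= h k.
Proof.
move=> s0 st; have t0 := le_trans s0 st.
have k0 : 0 < k.+1%:R :> R by rewrite ltr0n.
have /andP[s1 s2] := truncn_itv (mulr_ge0 s0 (ltW k0)).
have /andP[t1 t2] := truncn_itv (mulr_ge0 t0 (ltW k0)).
have -> : t - s = (t * k.+1%:R - s * k.+1%:R) * h k.
  by rewrite /h -mulrBl mulfK// gt_eqF.
rewrite -mulrBl normrM (gtr0_norm (h_gt0 k)) -[leRHS]mul1r ler_pM2r//.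
move: s1 s2 t1 t2; rewrite -/(idx k s) -/(idx k t) -(natr1 (idx k s)) -(natr1 (idx k t)).
move: (idx k s)%:R (idx k t)%:R (s * _) (t * _) => a b c e s1 s2 t1 t2.
by rewrite ler_norml; apply/andP; split; lra.
Qed.

Let X_lip k (s t : R) : 0 <= s -> s <= t -> `|X k t - X k s| <= (t - s + h k) * L.
Proof.
move=> s0 st.
apply: le_trans (euler_lipschitz FL x0 (ltW (h_gt0 k)) (idx_le k s0 st)) _.
rewrite ler_wpM2r//; have := idx_dist k s0 st.
by rewrite ler_norml => /andP[]; lra.
Qed.

(* The Euler polygons converge pointwise along an ultrafilter, so that no
   equicontinuity theorem is needed to extract a limit. *)
Lemma peano_bounded : exists x : R -> 'cV[R]_n,
  [/\ x 0 = x0, forall s t : R, 0 <= s -> s <= t -> `|x t - x s| <= L * (t - s) &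
      forall t : R, 0 < t -> is_derive t 1 x (F (x t))].
Proof.
have [U [UU ooU]] := ultraFilterLemma eventually_filter.
have hU e : 0 < e -> \forall k \near U, h k < e.
  move=> e0; apply: ooU; exists (Num.truncn e^-1) => // k /= ek.
  rewrite /h invf_plt ?posrE ?ltr0n// (lt_le_trans (truncnS_gt _))//.
  by rewrite ler_nat ltnS.
have X0 k : X k 0 = x0 by rewrite /X /idx mul0r truncn0.
(* The guard sits under the existential so that choice gives a function on all of R, arbitrary at
   negative times. *)
have cvgX t : exists l : 'cV[R]_n, (0 <= t -> X k t @[k --> U] --> l).
  have [t0|t0] := leP 0 t; last by exists 0.
  have Xb k : `|X k t| <= `|x0| + (t + 1) * L.
    rewrite -(subrK x0 (X k t)) addrC (le_trans (ler_normD _ _))// lerD2l.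
    rewrite -{1}(X0 k) (le_trans (X_lip k (lexx 0) t0))// subr0 ler_wpM2r//.
    by rewrite lerD2l /h invf_le1 ?ltr0n// ler1n.
  by have [l ?] := ultra_bounded_cvg UU Xb; exists l.
pose x t := sval (cid (cvgX t)).
have Xx t : 0 <= t -> X k t @[k --> U] --> x t := svalP (cid (cvgX t)).
have nearX t e : 0 <= t -> 0 < e -> \forall k \near U, `|x t - X k t| < e.
  by move=> t0 e0; exact: (cvgrPdist_lt _ _).1 (Xx t t0) _ e0.
have xlip (s t : R) : 0 <= s -> s <= t -> `|x t - x s| <= L * (t - s).
  move=> s0 st; have t0 := le_trans s0 st.
  apply/ler_addgt0Pr => e e0.
  (* Two distances to the limit and one [h k * L] share the error [e]. *)
  have e1 : 0 < e / (2 + L) by rewrite divr_gt0// ltr_wpDr.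
  near U => k.
  have k1 : `|x t - X k t| < e / (2 + L) by near: k; exact: nearX.
  have k2 : `|x s - X k s| < e / (2 + L) by near: k; exact: nearX.
  have k3 : h k < e / (2 + L) by near: k; exact: hU.
  rewrite (_ : _ - _ = (x t - X k t) + (X k t - X k s) - (x s - X k s)); last first.
    by rewrite subrKA opprB subrKA.
  rewrite (le_trans (ler_normB _ _))//.
  rewrite (le_trans (lerD (ler_normD _ _) (lexx _)))//.
  have := X_lip k s0 st.
  have : h k * L <= e / (2 + L) * L by rewrite ler_wpM2r// ltW.
  have : e / (2 + L) * (2 + L) = e by rewrite divfK// gt_eqF// ltr_wpDr.
  by move: k1 k2; nra.
exists x; split => //.
  have := Xx 0 (lexx 0); rewrite (_ : (fun k => X k 0) = cst x0).
    by move=> /(cvg_unique (@norm_hausdorff _ _)) /(_ (cvg_cst _)).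
  by apply/funext => k; rewrite X0.
move=> s s0; apply: is_derive_littleo => e e0.
have /cvgrPdist_le/(_ e e0)/nbhs_ballP[d /= d0 Fd] := @cF (x s).
(* At speed at most L the nodes of such a window stay within d / 2 of [X k s], itself within d / 2
   of [x s]. *)
have d1 : 0 < d / (2 * (L + 1)) by rewrite divr_gt0// mulr_gt0// ltr_wpDl.
(* Before passing to the limit, all Euler nodes between [a] and [b] are close
   to [x s]. *)
have xaff a b : 0 <= a -> a <= s -> s <= b -> b - a < d / (2 * (L + 1)) ->
    `|x b - x a - (b - a) *: F (x s)| <= e * (b - a).
  move=> a0 as_ sb bad; have ab := le_trans as_ sb; have b0 := le_trans a0 ab.
  have s0' := ltW s0.
  set f0 := F (x s); apply/ler_addgt0Pr => r r0.
  (* The errors to absorb: two distances to the limit, [h k * e] from [euler_affine], and [h k]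
     times the norm of [f0] from rounding times to nodes. *)
  pose K := 2 + e + `|f0|.
  have K0 : 0 < K by rewrite /K ltr_wpDr// ltr_wpDr// ltW.
  have r1 : 0 < r / K by rewrite divr_gt0.
  have g0 : 0 < (d / (2 * (L + 1)) - (b - a)) by rewrite subr_gt0.
  have g1 : 0 < d / 2 by rewrite divr_gt0.
  near U => k.
  have k1 : `|x b - X k b| < r / K by near: k; exact: nearX.
  have k2 : `|x a - X k a| < r / K by near: k; exact: nearX.
  have k3 : h k < r / K by near: k; exact: hU.
  have k4 : `|x s - X k s| < d / 2 by near: k; exact: nearX.
  have k5 : h k < d / (2 * (L + 1)) - (b - a) by near: k; exact: hU.
  have Xaff : `|X k b - X k a - (((idx k b)%:R - (idx k a)%:R) * h k) *: f0| <=
      (b - a + h k) * e.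
    have ia := idx_le k a0 as_; have ib := idx_le k s0' sb.
    have Eab := idx_dist k a0 ab.
    apply: (le_trans (euler_affine (y := f0) (ltW (h_gt0 k)) (ltW e0) (idx_le k a0 ab) _)).
      move=> j /andP[aj jb]; rewrite distrC; apply: Fd; rewrite -ball_normE /ball_/=.
      rewrite -(subrKA (X k s)) (le_lt_trans (ler_normD _ _))//.
      rewrite [ltRHS](splitr d) ltr_leD//.
      have H : `|X k s - euler F (h k) x0 j| <= ((idx k b)%:R - (idx k a)%:R) * h k * L.
        have [js|js] := leqP j (idx k s).
          apply: (le_trans (euler_lipschitz FL x0 (ltW (h_gt0 k)) js)).
          rewrite !ler_wpM2r ?(ltW (h_gt0 k))// lerB// ler_nat//.
        rewrite distrC.
        apply: (le_trans (euler_lipschitz FL x0 (ltW (h_gt0 k)) (ltnW js))).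
        by rewrite !ler_wpM2r ?(ltW (h_gt0 k))// lerB// ler_nat// ltnW.
      apply: (le_trans H).
      have {}Eab : ((idx k b)%:R - (idx k a)%:R) * h k <= d / (2 * (L + 1)).
        by move: Eab k5; rewrite ler_norml => /andP[]; lra.
      apply: (@le_trans _ _ (d / (2 * (L + 1)) * (L + 1))).
        rewrite ler_pM// ?lerDl ?mulr_ge0 ?(ltW (h_gt0 k))//.
        by rewrite subr_ge0 ler_nat idx_le.
      by rewrite (_ : _ * _ = d / 2)//; field; rewrite gt_eqF// ltr_wpDl.
    rewrite ler_wpM2r ?(ltW e0)//.
    by move: Eab; rewrite ler_norml => /andP[]; lra.
  have Ef : `|(((idx k b)%:R - (idx k a)%:R) * h k) *: f0 - (b - a) *: f0| <= h k * `|f0|.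
    by rewrite -scalerBl normrZ ler_wpM2r// idx_dist.
  set c1 := (_ * h k) *: f0 in Xaff Ef *; set c2 := (b - a) *: f0 in Ef *.
  rewrite (_ : _ - c2 = (X k b - X k a - c1) + (x b - X k b) - (x a - X k a) +
     (c1 - c2)); last first.
    rewrite opprB (addrC (_ - c1)) -(addrA (X k b)) subrKA (addrC (- X k a)).
    by rewrite (addrA (x b)) subrKA (addrAC (x b) (- c1)) subrKA.
  rewrite (le_trans (ler_normD _ _))// (le_trans (lerD (ler_normB _ _) (lexx _)))//.
  rewrite (le_trans (lerD (lerD (ler_normD _ _) (lexx _)) (lexx _)))//.
  have rK : r / K * K = r by rewrite divfK// gt_eqF.
  have := ler_wpM2r (ltW e0) (ltW k3).
  have := ler_wpM2r (normr_ge0 f0) (ltW k3).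
  move: rK; rewrite /K; move: k1 k2 Xaff Ef; rewrite !mulrDr mulrDl; lra.
exists (Num.min s (d / (2 * (L + 1)))); first by rewrite lt_min s0.
move=> t; rewrite lt_min => /andP[ts td].
have t0 : 0 <= t by move: ts; rewrite ltr_norml => /andP[]; lra.
have [st|/ltW ts'] := leP s t.
  move: td; rewrite ger0_norm ?subr_ge0// => td.
  exact: xaff (ltW s0) (lexx s) st td.
move: td; rewrite distrC ger0_norm ?subr_ge0// => td.
rewrite -normrN (_ : - _ = x s - x t - (s - t) *: F (x s)).
  exact: xaff t0 ts' (lexx s) td.
by rewrite opprB [in LHS]opprB [LHS]addrC -scaleNr opprB.
Unshelve. all: by end_near. Qed.

End PeanoLimit.

(** * Existence on a prescribed interval from an a priori bound *)

Section OdeExistence.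
Context {R : realType} {n : nat}.
Implicit Types (f : 'cV[R]_n -> 'cV[R]_n) (x : R -> 'cV[R]_n) (B b H : R).

Definition ode_solution f b x : Prop :=
  {within `[0, b], continuous x} /\
  forall t : R, 0 < t -> t < b -> is_derive t 1 x (f (x t)).

Lemma ode_solutionW f b b' x : b' <= b -> ode_solution f b x -> ode_solution f b' x.
Proof.
move=> bb [cx dx]; split.
  by apply: continuous_subspaceW cx; apply: subset_itvl; rewrite bnd_simp.
by move=> t t0 tb; apply: dx => //; exact: lt_le_trans bb.
Qed.

(** Projection onto the sup-norm ball: composing a continuous field with it makes the field bounded,
    as [peano_bounded] requires, without changing it on the ball. *)
Definition clip B (y : 'cV[R]_n) : 'cV[R]_n :=
  \col_i Num.max (- B) (Num.min B (y i 0)).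

Lemma norm_clip B y : 0 <= B -> `|clip B y| <= B.
Proof.
move=> B0; apply: norm_cV_le => // i; rewrite mxE ler_norml le_max lexx/=.
by rewrite ge_max ge_min lexx/= andbT; lra.
Qed.

Lemma clip_id B y : `|y| <= B -> clip B y = y.
Proof.
move=> yB; apply/colP => i; rewrite mxE.
have := le_trans (norm_cV_ge y i) yB; rewrite ler_norml => /andP[h1 h2].
by rewrite min_r// max_r.
Qed.

Lemma max_lipschitz (c a b : R) : `|Num.max c a - Num.max c b| <= `|a - b|.
Proof.
have := ler_norm (a - b); have := ler_norm (- (a - b)); rewrite normrN.
by case: (leP c a) => ?; case: (leP c b) => ? /=; rewrite ler_norml => ? ?;
  apply/andP; split; lra.
Qed.

Lemma min_lipschitz (c a b : R) : `|Num.min c a - Num.min c b| <= `|a - b|.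
Proof.
have := ler_norm (a - b); have := ler_norm (- (a - b)); rewrite normrN.
by case: (leP c a) => ?; case: (leP c b) => ? /=; rewrite ler_norml => ? ?;
  apply/andP; split; lra.
Qed.

Lemma clip_lipschitz B y z : `|clip B y - clip B z| <= `|y - z|.
Proof.
apply: norm_cV_le => // i; apply: le_trans (norm_cV_ge _ i); rewrite !mxE.
exact: le_trans (max_lipschitz _ _ _) (min_lipschitz _ _ _).
Qed.

Lemma lipschitz_continuous {V W : normedModType R} (g : V -> W) (L : R) :
  (forall y z, `|g y - g z| <= L * `|y - z|) -> continuous g.
Proof.
move=> gL y; apply/cvgrPdist_le => e e0; near=> z.
rewrite (le_trans (gL _ _))//.
have L1 : 0 < `|L| + 1 by rewrite ltr_wpDl.
apply: (@le_trans _ _ ((`|L| + 1) * `|y - z|)).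
  by rewrite ler_wpM2r// (le_trans (ler_norm _))// lerDl.
rewrite -ler_pdivlMl// mulrC; near: z; apply: cvgr_dist_le => //; exact: divr_gt0.
Unshelve. all: by end_near. Qed.

(* A solution of the clipped equation cannot be the first to leave the ball
   of radius [B + 1], hence solves the original one. *)
Lemma ode_exists f (x0 : 'cV[R]_n) B H : continuous f ->
  (forall b x, 0 <= b -> b <= H -> ode_solution f b x -> x 0 = x0 -> `|x b| <= B) ->
  exists x, [/\ continuous x, x 0 = x0, ode_solution f H x &
    forall t : R, 0 <= t -> t <= H -> `|x t| <= B].
Proof.
move=> cf apriori.
have [H0|H0] := ltP H 0.
  exists (cst x0); split => //.
  - by move=> ?; exact: cvg_cst.
  - split; first by move=> ?; exact: cvg_cst.
    by move=> t t0 /(lt_trans t0)/(lt_trans H0); rewrite ltxx.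
  - by move=> t t0 /(le_trans t0); rewrite leNgt H0.
have x0B : `|x0| <= B.
  apply: (apriori 0 (cst x0)) => //; split; first by move=> ?; exact: cvg_cst.
  by move=> t t0 /(lt_trans t0); rewrite ltxx.
have B0 : 0 <= B by exact: le_trans x0B.
pose M := B + 1; have M0 : 0 <= M by rewrite addr_ge0.
have cfM : continuous (f \o clip M).
  move=> y; apply: continuous_comp; last exact: cf.
  apply: (@lipschitz_continuous _ _ _ 1) => u v; rewrite mul1r.
  exact: clip_lipschitz.
have [L L0 fL] := bounded_image_ball M cf.
have [|y [y0 yL dy]] := peano_bounded x0 cfM L0.
  by move=> z; apply: fL; exact: norm_clip.
(* Nothing is known of [y] at negative times; freezing it at 0 gives a function continuous on R. *)
pose x (t : R) := y (Num.max t 0).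
have xE (t : R) : 0 <= t -> x t = y t by move=> t0; rewrite /x max_l.
have cx : continuous x.
  apply: (@lipschitz_continuous _ _ _ L) => s t.
  wlog st : s t / s <= t => [hw|].
    have [|/ltW] := leP s t; first exact: hw.
    by rewrite distrC (distrC s); exact: hw.
  have st0 : Num.max s 0 <= Num.max t 0 by rewrite ge_max !le_max st lexx orbT.
  rewrite distrC (le_trans (yL (Num.max s 0) _ _ st0)) ?le_max ?lexx ?orbT//.
  rewrite ler_wpM2l// (le_trans (ler_norm _))// [leRHS]distrC !(maxC _ 0).
  exact: max_lipschitz.
have dx (t : R) : 0 < t -> is_derive t 1 x (f (clip M (x t))).
  move=> t0; rewrite xE ?ltW//; apply: near_eq_is_derive (dy t t0).
  near=> s; rewrite /x max_l// ltW//; near: s; exact: lt_nbhsr.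
have sol (b : R) : 0 <= b -> (forall t : R, 0 <= t -> t < b -> `|x t| <= M) -> ode_solution f b x.
  move=> b0 xM; split; first exact: continuous_subspaceT.
  by move=> t t0 tb; rewrite -(clip_id (xM t (ltW t0) tb)); exact: dx.
have x00 : x 0 = x0 by rewrite xE.
have xM (t : R) : 0 <= t -> t <= H -> `|x t| <= M.
  move=> t0 tH; rewrite leNgt; apply/negP => tM.
  (* Up to [inf A] both equations agree, so the a priori bound gives norm at most B at [inf A]; but
     there are points of [A] arbitrarily close, where the norm exceeds B + 1. *)
  pose A := [set s | 0 <= s /\ M < `|x s|].
  have Ainf : has_inf A by split; [exists t|exists 0 => s []].
  have inf0 : 0 <= inf A by apply: lb_le_inf; [exists t|move=> s []].
  have infM (s : R) : 0 <= s -> s < inf A -> `|x s| <= M.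
    move=> s0 sA; rewrite leNgt; apply/negP => sM.
    by have := inf_lbound Ainf.2; move/(_ s); rewrite leNgt sA => /(_ (conj s0 sM)).
  have infH : inf A <= H by apply: le_trans tH; apply: (inf_lbound Ainf.2).
  have xinf : `|x (inf A)| <= B by apply: apriori (sol _ inf0 infM) _.
  have /cvgrPdist_lt/(_ 1 ltr01)/nbhs_ballP[d /= d0 xd] := cx (inf A).
  have [s [s0 sM] sd] := inf_adherent d0 Ainf.
  have xs : `|x (inf A) - x s| < 1.
    apply: xd; rewrite -ball_normE /= distrC ger0_norm ?ltrBlDl//.
    by rewrite subr_ge0; apply: (inf_lbound Ainf.2).
  have : `|x s| <= `|x (inf A)| + `|x (inf A) - x s|.
    by rewrite -{1}(subrK (x (inf A)) (x s)) addrC (le_trans (ler_normD _ _))// distrC.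
  by move: sM; rewrite /M; lra.
have solH : ode_solution f H x.
  by apply: sol => // t t0 /ltW; exact: xM.
exists x; split => // t t0 tH; apply: apriori => //.
exact: ode_solutionW solH.
Unshelve. all: by end_near. Qed.

End OdeExistence.

(** * Derivatives of W along the chain of integrators *)

Section ChainOfIntegrators.
Context {R : realType} {n : nat}.
Implicit Types (x y z : 'cV[R]_n) (a : R).

Definition chain_field y a : 'cV[R]_n := jordan0 *m y + a *: e_last.

Lemma jordan0_coord y (i j : 'I_n) : j = i.+1 :> nat -> (jordan0 *m y) i 0 = y j 0.
Proof.
move=> ji; rewrite mxE (bigD1 j)//= big1 ?addr0 ?mxE ?ji ?eqxx ?mul1r// => k kj.
rewrite mxE (_ : (k == i.+1 :> nat) = false) ?mul0r//.
by apply: contraNF kj => /eqP ki; apply/eqP/val_inj; rewrite /= ji.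
Qed.

Lemma jordan0_last y (i : 'I_n) : i.+1 = n -> (jordan0 *m y) i 0 = 0.
Proof.
move=> iN; rewrite mxE big1// => k _; rewrite mxE (_ : (k == i.+1 :> nat) = false) ?mul0r//.
by rewrite iN ltn_eqF.
Qed.

Lemma chain_field_coord_le y a i : `|chain_field y a i 0| <= \sum_j `|y j 0| + `|a|.
Proof.
rewrite !mxE (le_trans (ler_normD _ _))// lerD//.
  rewrite (le_trans (ler_norm_sum _ _ _))// ler_sum// => j _.
  by rewrite mxE normrM; case: (_ == _); rewrite ?normr1 ?mul1r ?normr0 ?mul0r.
by rewrite normrM; case: (_ == _); rewrite ?normr1 ?mulr1 ?normr0 ?mulr0.
Qed.

Lemma continuous_sum (T : topologicalType) I (r : seq I) (g : I -> T -> R) :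
  (forall i, continuous (g i)) -> continuous (fun t => \sum_(i <- r) g i t).
Proof.
move=> cg; elim: r => [|i r IH].
  by move=> t; under eq_fun do rewrite big_nil; exact: cvg_cst.
by move=> t; under eq_fun do rewrite big_cons; apply: cvgD; [exact: cg|exact: IH].
Qed.

Lemma continuous_mulmx (A : 'M[R]_n) : continuous (fun y => A *m y).
Proof.
move=> y; apply: (@cvg_cV R n 'cV[R]_n (nbhs y) _ (fun z => A *m z)) => i.
under eq_fun do rewrite mxE.
rewrite mxE; apply: (continuous_sum (g := fun j z => A i j * z j 0)) => j z.
apply: (continuous_comp (f := fun z : 'cV_n => z j 0) (g := fun b => A i j * b)).
  exact: coord_continuous.
exact: mulrl_continuous.
Qed.

Lemma continuous_chain_field (u : 'cV[R]_n -> R) :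
  continuous u -> continuous (fun y => chain_field y (u y)).
Proof.
move=> cu y.
apply: (@cvgD _ _ _ (nbhs y) _ (fun z => jordan0 *m z) (fun z => u z *: e_last)).
  exact: continuous_mulmx.
by apply: cvgZr_tmp => //; exact: cu.
Qed.

End ChainOfIntegrators.

Section LyapunovDerivative.
Context {R : realType} {n : nat}.
Variables (W : 'cV[R]_n -> R) (C0 m : R).
Hypotheses (W_C1 : cont_diff W) (m_gt0 : 0 < m).
Implicit Types (x y z : 'cV[R]_n) (a k : R).

(* [F_of W C0 m x] with the point [z] at which W is differentiated decoupled
   from the point [x] at which the drift is evaluated. *)
Definition F_split z x : R :=
  C0 * `|'D_e_last W z| `^ m - ((grad W z)^T *m (jordan0 *m x)) 0 0.

Definition feedback k x : R := - k * sgn_pow ('D_e_last W x) (m - 1).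

Lemma continuous_C1 : continuous W.
Proof. by move=> x; apply: differentiable_continuous; exact: W_C1.1. Qed.

Lemma is_derive_C1_comp (x : R -> 'cV[R]_n) (t : R) y :
  is_derive t 1 x y -> is_derive t 1 (W \o x) ('D_y W (x t)).
Proof.
move=> [/derivable1_diffP dx xy].
have dW := W_C1.1 (x t).
have dWx : differentiable (W \o x) t by exact: differentiable_comp.
apply: DeriveDef; first exact: diff_derivable.
by rewrite !deriveE// diff_comp//= -xy deriveE.
Qed.

Lemma derive_chain_field z x a :
  'D_(chain_field x a) W z =
  C0 * `|'D_e_last W z| `^ m - F_split z x + a * 'D_e_last W z.
Proof.
have dW := W_C1.1 z.
rewrite /F_split opprB subrKC.
rewrite /chain_field deriveE// linearD linearZ/= -!deriveE//; congr (_ + _).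
rewrite mxE deriveE//; set v := jordan0 *m x.
rewrite {1}[v]matrix_sum_delta raddf_sum/=; apply: eq_bigr => i _.
by rewrite big_ord1 linearZ/= !mxE mulrC deriveE.
Qed.

Lemma derive_feedback k x : 1 < m ->
  'D_(chain_field x (feedback k x)) W x =
  - F_of W C0 m x - (k - C0) * `|'D_e_last W x| `^ m.
Proof.
move=> m1; rewrite derive_chain_field -/(F_of W C0 m x) /feedback.
rewrite mulNr mulNr -mulrA [_ * 'D__ W x]mulrC sgn_powM// (_ : F_split x x = F_of W C0 m x)//; ring.
Qed.

(** Joint continuity controls the error made when the gradient is frozen in [running_cost_bound]. *)
Lemma continuous_F_split : continuous (fun p => F_split p.1 p.2).
Proof.
move=> p; apply: cvgB.
  apply: cvgMl_tmp; apply: (continuous_comp (f := fun p => 'D_e_last W p.1) (g := fun b => `|b| `^ m)).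
    apply: (continuous_comp (f := fst) (g := fun z => 'D_e_last W z)); first exact: cvg_fst.
    exact: W_C1.2.
  exact: continuous_norm_powR.
under eq_fun do rewrite mxE; rewrite mxE.
apply: (continuous_sum (g := fun i p => (grad W p.1)^T 0 i * (jordan0 *m p.2) i 0)) => i q.
under eq_fun do rewrite [(grad W _)^T _ _]mxE [grad W _ _ _]mxE.
apply: (cvgM (F := nbhs q) (f := fun p => 'D_(delta_mx i 0) W p.1) (g := fun p => (jordan0 *m p.2) i 0)).
  apply: (continuous_comp (f := fst) (g := fun z => 'D_(delta_mx i 0) W z)); first exact: cvg_fst.
  exact: W_C1.2.
apply: (continuous_comp (f := snd) (g := fun z => (jordan0 *m z) i 0)); first exact: cvg_snd.
apply: (continuous_comp (f := fun z => jordan0 *m z) (g := fun z : 'cV_n => z i 0)).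
  exact: continuous_mulmx.
exact: coord_continuous.
Qed.

Lemma continuous_F_of : continuous (F_of W C0 m).
Proof.
move=> x; apply: (continuous_comp (f := fun x => (x, x)) (g := fun p => F_split p.1 p.2)).
  exact: (cvg_pair (F := nbhs x) (f := id) (g := id) cvg_id cvg_id).
exact: continuous_F_split.
Qed.

Lemma continuous_feedback k : 1 < m -> continuous (feedback k).
Proof.
move=> m1 x.
apply: (cvgMl_tmp (F := nbhs x) (g := fun z => sgn_pow ('D_e_last W z) (m - 1))).
apply: (continuous_comp (f := fun z => 'D_e_last W z) (g := fun b => sgn_pow b (m - 1))).
  exact: W_C1.2.
by apply: continuous_sgn_pow; rewrite subr_gt0.
Qed.

End LyapunovDerivative.

(** * Coercivity of W *)

Section Coercivity.
Context {R : realType} {n : nat}.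
Variables (W : 'cV[R]_n -> R) (C0 m alpha1 d mu : R).
Hypotheses (W_C1 : cont_diff W) (W_pos : pos_def W).
Hypotheses (C0_gt0 : 0 < C0) (m_gt1 : 1 < m) (alpha1_gt0 : 0 < alpha1).
Hypotheses (d_gt0 : 0 < d) (mu_gt0 : 0 < mu) (mu_lt : mu < d / (m * n%:R)).
Implicit Types (x y : 'cV[R]_n).

(** Homogeneous of degree d for the dilations of these weights: the d-th power of a homogeneous
    norm. *)
Definition weighted_sum x : R := \sum_(i < n) `|x i 0| `^ (d / weight d m mu i).

Hypothesis F_ge : forall x, alpha1 * weighted_sum x <= F_of W C0 m x.

Let m_gt0 : 0 < m. Proof. exact: lt_trans ltr01 m_gt1. Qed.

Lemma weight_gt0 (i : 'I_n) : 0 < weight d m mu i.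
Proof.
rewrite /weight ltr_wpDr ?mulr_ge0 ?(ltW mu_gt0)//.
by rewrite divr_gt0// mulr_gt0// subr_gt0.
Qed.

(** The bound on mu enters here: n mu < d / m, while d (m - 1) / m = d - d / m. *)
Lemma weight_lt (i : 'I_n) : weight d m mu i < d.
Proof.
have n0 : 0 < n%:R :> R by case: n i => [[]//|k _]; rewrite ltr0n.
have : n%:R * mu < d / m.
  by rewrite mulrC -ltr_pdivlMr// -mulrA -invfM.
have : (n - i)%:R * mu <= n%:R * mu by rewrite ler_wpM2r ?(ltW mu_gt0)// ler_nat leq_subr.
have : d * (m - 1) / m = d - d / m by field; rewrite gt_eqF.
by rewrite /weight => ->; lra.
Qed.

Lemma weight_exp_gt1 (i : 'I_n) : 1 < d / weight d m mu i.
Proof. by rewrite ltr_pdivlMr ?weight_gt0// mul1r weight_lt. Qed.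

Lemma weighted_sum_ge0 x : 0 <= weighted_sum x.
Proof. by apply: sumr_ge0 => i _; exact: powR_ge0. Qed.

Lemma W_ge0 x : 0 <= W x.
Proof. by have [->|/W_pos.2/ltW//] := eqVneq x 0; rewrite W_pos.1. Qed.

Lemma F_of_ge0 x : 0 <= F_of W C0 m x.
Proof. by apply: le_trans (F_ge x); rewrite mulr_ge0 ?(ltW alpha1_gt0)// weighted_sum_ge0. Qed.

Lemma weighted_sum_ge_l1 x : \sum_i `|x i 0| <= n%:R + weighted_sum x.
Proof.
rewrite -[n in n%:R]card_ord -sum1_card natr_sum -big_split/= ler_sum// => i _.
by rewrite le_add1_powR// ltW// weight_exp_gt1.
Qed.

Local Notation u := (feedback W m (m * C0)).

Lemma dissipation : exists c1 c2 : R, [/\ 0 < c1, 0 <= c2 & forall x,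
  'D_(chain_field x (u x)) W x <= c2 - c1 * (\sum_i `|x i 0| + `|u x|)].
Proof.
(* [alpha1] serves the state; [(m - 1) / m] turns the factor m C0 in the bound [ux] of the input
   into (m - 1) C0, the surplus of the gain m C0 over C0. *)
pose c1 := Num.min alpha1 ((m - 1) / m).
have m10 : 0 < m - 1 by rewrite subr_gt0.
have c10 : 0 < c1 by rewrite lt_min alpha1_gt0 divr_gt0.
exists c1, (alpha1 * n%:R + (m - 1) * C0); split=> // [|x].
  by rewrite addr_ge0// mulr_ge0// ltW.
rewrite (derive_feedback C0)//.
set D := 'D_e_last W x.
have ux : `|u x| <= m * C0 * (1 + `|D| `^ m).
  rewrite /feedback normrM normrN norm_sgn_pow ?gt_eqF ?subr_gt0// gtr0_norm ?mulr_gt0//.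
  rewrite ler_pM2l ?mulr_gt0// -/D.
  (* |D|^(m - 1) is at most |D|^m if |D| >= 1, and at most 1 otherwise. *)
  have [D1|D1] := leP 1 `|D|.
    by rewrite (@le_trans _ _ (`|D| `^ m)) ?lerDr//; apply: ler_powR => //; lra.
  rewrite (@le_trans _ _ 1) ?lerDl ?powR_ge0//.
  have [D0|D0] := eqVneq `|D| 0; first by rewrite D0 powR0 ?gt_eqF.
  rewrite -[leRHS](powRr0 `|D|); apply: ger_powR; rewrite ?(ltW m10)//.
  by rewrite lt_neqAle eq_sym D0 normr_ge0 ltW.
have H1 : c1 * \sum_i `|x i 0| <= alpha1 * (n%:R + weighted_sum x).
  apply: ler_pM; rewrite ?(ltW c10)//; first exact: sumr_ge0.
    by rewrite ge_min lexx.
  exact: weighted_sum_ge_l1.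
have H2 : c1 * `|u x| <= (m - 1) * C0 * (1 + `|D| `^ m).
  apply: (@le_trans _ _ ((m - 1) / m * (m * C0 * (1 + `|D| `^ m)))).
    by apply: ler_pM; rewrite ?(ltW c10)// ge_min lexx orbT.
  by rewrite le_eqVlt; apply/orP; left; apply/eqP; field; rewrite gt_eqF.
by have := F_ge x; move: H1 H2; lra.
Qed.

(* The growth of a coordinate of the state is paid for by the decrease of [W]. *)
Lemma ode_solution_tradeoff (x : R -> 'cV[R]_n) (T c1 c2 s a b : R) i :
  (forall y, 'D_(chain_field y (u y)) W y <= c2 - c1 * (\sum_i `|y i 0| + `|u y|)) ->
  0 <= c1 -> `|s| = 1 -> 0 <= T -> -1 <= b <= 0 -> a <= 1 -> 0 <= a + b * T ->
  ode_solution (fun y => chain_field y (u y)) T x ->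
  W (x T) + (a + b * T) * (c1 / 2 * s * x T i 0) <=
  W (x 0) + a * (c1 / 2 * s * x 0 i 0) + c2 * T.
Proof.
move=> dW c10 s1 T0 /andP[b1 b0] a1 abT [cx dx].
(* The weight a + b t lies in [0, 1] and its slope in [-1, 0]. So the velocity and the coordinate
   each enter the derivative with a factor at most c1 / 2, and together they are absorbed by the
   dissipation. *)
pose g (t : R) := W (x t) + (a + b * t) * (c1 / 2 * s * x t i 0) + - c2 * t.
suff : g T <= g 0 by rewrite /g !mulr0 !addr0; lra.
apply: (@derive_le0_le _ g (fun t => 'D_(chain_field (x t) (u (x t))) W (x t) +
    ((a + b * t) * (c1 / 2 * s * chain_field (x t) (u (x t)) i 0) +
     b * (c1 / 2 * s * x t i 0)) + - c2)) => // [|t t0 tT|t t0 tT].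
- have cWx : {within `[0, T], continuous (W \o x)}.
    by move=> t; apply: continuous_comp (cx t) _; exact: continuous_C1.
  have cab (k l : R) : {within `[0, T], continuous (fun t => k + l * t)}.
    apply: continuous_subspaceT => r; apply: cvgD; first exact: cvg_cst.
    exact: mulrl_continuous.
  have cxi : {within `[0, T], continuous (fun t => c1 / 2 * s * x t i 0)}.
    move=> t; apply: (continuous_comp (g := fun y : 'cV_n => c1 / 2 * s * y i 0) (cx t)).
    apply: (continuous_comp (f := fun y : 'cV_n => y i 0) (g := fun r => c1 / 2 * s * r)).
      exact: coord_continuous.
    exact: mulrl_continuous.
  have cc2 : {within `[0, T], continuous (fun t => - c2 * t)}.
    by apply: continuous_subspaceT => r; exact: mulrl_continuous.
  by move=> t; exact: cvgD (cvgD (cWx t) (cvgM (cab a b t) (cxi t))) (cc2 t).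
- apply: is_derive_affine_mul; first exact/is_derive_C1_comp/dx.
  rewrite (_ : (fun t => c1 / 2 * s * x t i 0) = (c1 / 2 * s) \*: (fun t => x t i 0))//.
  by apply: is_deriveZ; apply: ((is_derive_cVP _ _ _).1 (dx t t0 tT)).
- set y := x t; set f := chain_field y (u y).
  have abt : 0 <= a + b * t.
    by rewrite (le_trans abT)// lerD2l ler_wnM2l// ltW.
  have abt1 : a + b * t <= 1.
    by rewrite (le_trans _ a1)// gerDl mulr_le0_ge0// ltW.
  have fi := chain_field_coord_le y (u y) i; rewrite -/f in fi.
  have yi : `|y i 0| <= \sum_j `|y j 0| + `|u y|.
    by rewrite (bigD1 i)//= -addrA lerDl addr_ge0// sumr_ge0.
  set N := _ + `|u y| in fi yi.
  have H1 : (a + b * t) * (c1 / 2 * s * f i 0) <= c1 / 2 * N.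
    rewrite (le_trans (ler_norm _))// !normrM s1 mulr1 (ger0_norm abt).
    rewrite (ger0_norm c10) (ger0_norm (_ : 0 <= 2^-1))// -[leRHS]mul1r ler_pM//.
      by rewrite mulr_ge0// divr_ge0.
    by rewrite ler_wpM2l// divr_ge0.
  have H2 : b * (c1 / 2 * s * y i 0) <= c1 / 2 * N.
    rewrite (le_trans (ler_norm _))// !normrM s1 mulr1 (ler0_norm b0).
    rewrite (ger0_norm c10) (ger0_norm (_ : 0 <= 2^-1))// -[leRHS]mul1r ler_pM//.
    - by rewrite oppr_ge0.
    - by rewrite mulr_ge0// divr_ge0.
    - by rewrite lerNl.
    - by rewrite ler_wpM2l// divr_ge0.
  by have := dW y; rewrite -/f -/N; move: H1 H2; lra.
Qed.

Lemma W_coercive : exists2 c, 0 < c & exists c2, forall x, c * `|x| <= c2 + W x.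
Proof.
have [c1 [c2 [c10 c20 dW]]] := dissipation.
exists (c1 / 2); first exact: divr_gt0.
exists c2 => x0.
have c12 : 0 < c1 / 2 by exact: divr_gt0.
pose B := `|x0| + (c2 + W x0) / (c1 / 2).
have B0 : 0 <= B by rewrite addr_ge0// divr_ge0 ?(ltW c12)// addr_ge0 ?W_ge0.
have [||x [cx x00 xsol _]] := @ode_exists _ _ (fun y => chain_field y (u y)) x0 B 1.
- exact/continuous_chain_field/continuous_feedback.
(* The constant weight 1 bounds the endpoint [x b], which is the a priori bound for existence on
   [0, 1]. *)
- move=> b x b0 b1 xsol xx0; apply: norm_cV_le => // i.
  have key s : `|s| = 1 -> s * x b i 0 <= B.
    move=> s1.
    have := ode_solution_tradeoff i (a := 1) (b := 0) dW (ltW c10) s1 b0 _ (lexx 1) _ xsol.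
    rewrite lexx lerN10 mul0r addr0 !mul1r ler01 => /(_ isT isT).
    rewrite xx0 => H.
    have {}H : c1 / 2 * (s * x b i 0) <= c1 / 2 * (s * x0 i 0) + W x0 + c2.
      have := W_ge0 (x b); have := ler_piMr c20 b1; rewrite !mulrA; lra.
    rewrite -(ler_pM2l c12) (le_trans H)// mulrDr (mulrC _ (_ / (c1 / 2))) divfK ?gt_eqF//.
    rewrite -addrA (addrC c2) lerD2r ler_pM2l// (le_trans (ler_norm _))//.
    by rewrite normrM s1 mul1r norm_cV_ge.
  by rewrite ler_norml lerNl -mulN1r key ?normrN1//= -[x b i 0]mul1r key ?normr1.
- rewrite mulrC -ler_pdivlMr//; apply: norm_cV_le.
    by rewrite divr_ge0 ?(ltW c12)// addr_ge0 ?W_ge0.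
  (* The weight 1 - t, taken with the sign -s, erases the endpoint [x 1] and leaves only the initial
     coordinate. *)
  move=> i; have key s : `|s| = 1 -> s * x0 i 0 <= (c2 + W x0) / (c1 / 2).
    move=> s1.
    have := ode_solution_tradeoff i (s := - s) (a := 1) (b := -1) dW (ltW c10) _ ler01 _ (lexx 1) _ xsol.
    rewrite normrN lexx lerN10 mulr1 subrr lexx mul0r addr0 mul1r => /(_ s1 isT isT).
    rewrite x00 ler_pdivlMr// => H.
    by have := W_ge0 (x 1); move: H; rewrite mulrN mulNr mulr1 -mulrA; lra.
  by rewrite ler_norml lerNl -mulN1r key ?normrN1//= -[x0 i 0]mul1r key ?normr1.
Qed.

End Coercivity.

(** * Upper bound on W by polynomial steering *)

Section SteeringPolynomials.
Context {R : realType}.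
Implicit Types (p r : {poly R}) (a s : R).

Lemma derivn_mul_XsubCn_root a k j r : (j < k)%N ->
  ((('X - a%:P) ^+ k * r)^`(j)).[a] = 0.
Proof.
elim: j k r => [|j IH] [//|k] r jk.
  by rewrite derivn0 hornerM horner_exp hornerXsubC subrr expr0n mul0r.
rewrite /derivn iterSr -/(derivn j _).
suff -> : ((('X - a%:P) ^+ k.+1 * r)^`())%R =
    ('X - a%:P) ^+ k * (r *+ k.+1 + ('X - a%:P) * r^`())%R by exact: IH.
rewrite derivM deriv_exp derivXsubC mul1r mulrDr mulrA -exprSr.
by rewrite mulrnAl mulrnAr.
Qed.

(* With [b = 1] modulo [X^n] and [b = 0] modulo [(X - 1)^n], the Hermite basis
   polynomials are [X^k b / k!]. *)
Lemma steering_poly n : exists P : 'I_n -> {poly R}, forall k (j : nat), (j < n)%N ->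
  (P k)^`(j).[0] = (j == k)%:R /\ (P k)^`(j).[1] = 0.
Proof.
have /Bezout_eq1_coprimepP[[u v] /= uv] :
    coprimep (('X - 0%:P) ^+ n) (('X - 1%:P) ^+ n : {poly R}).
  by rewrite coprimep_expl// coprimep_expr// coprimep_XsubC2// oppr_eq0 ?subr_eq0 oner_eq0.
pose b := ('X - 1%:P) ^+ n * v.
exists (fun k => (k`!)%:R^-1 *: ('X^k * b)) => k j jn; split.
  have -> : (k`!)%:R^-1 *: ('X^k * b) =
      (k`!)%:R^-1 *: 'X^k - ('X - 0%:P) ^+ n * ((k`!)%:R^-1 *: ('X^k * u)).
    rewrite -[X in X - _]mulr1 -uv /b -scalerAr -scalerAl -scalerBr; congr (_ *: _); ring.
  rewrite derivnB hornerD hornerN derivn_mul_XsubCn_root// subr0.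
  rewrite derivnZ hornerZ derivnXn hornerMn hornerXn expr0n.
  have [->|jk] := eqVneq j k.
    by rewrite subnn eqxx ffactnn mulVf// pnatr_eq0 -lt0n fact_gt0.
  have [jk'|jk'] := ltnP j k; first by rewrite subn_eq0 leqNgt jk' mul0rn mulr0.
  by rewrite ffact_small ?mulr0n ?mulr0// ltn_neqAle eq_sym jk.
rewrite (_ : _ *: _ = ('X - 1%:P) ^+ n * ((k`!)%:R^-1 *: ('X^k * v))).
  exact: derivn_mul_XsubCn_root.
by rewrite /b -scalerAr mulrCA.
Qed.

Lemma horner_bounded p : exists M : R, forall s, 0 <= s <= 1 -> `|p.[s]| <= M.
Proof.
exists (\sum_(i < size p) `|p`_i|) => s /andP[s0 s1].
rewrite horner_coef (le_trans (ler_norm_sum _ _ _))// ler_sum// => i _.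
by rewrite normrM ler_piMr// ger0_norm ?exprn_ge0// exprn_ile1.
Qed.

Lemma horner_bounded_family (I J : finType) (p : I -> J -> {poly R}) :
  exists2 M : R, 0 <= M & forall i j s, 0 <= s <= 1 -> `|(p i j).[s]| <= M.
Proof.
pose M i j := sval (cid (horner_bounded (p i j))).
have pM i j s : 0 <= s <= 1 -> `|(p i j).[s]| <= M i j.
  by rewrite /M; case: cid => ? /=; exact.
have M0 i j : 0 <= M i j by apply: le_trans (pM i j 0 _); rewrite // lexx ler01.
exists (\sum_i \sum_j M i j); first by apply: sumr_ge0 => i _; exact: sumr_ge0.
move=> i j s s01; rewrite (le_trans (pM i j s s01))// (bigD1 i)//= (bigD1 j)//=.
by rewrite -addrA lerDl addr_ge0 ?sumr_ge0// => k _; exact: sumr_ge0.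
Qed.

End SteeringPolynomials.

Section UpperBound.
Context {R : realType} {n : nat}.
Variables (W : 'cV[R]_n -> R) (C0 m alpha2 d mu : R).
Hypotheses (W_C1 : cont_diff W) (W_pos : pos_def W).
Hypotheses (C0_gt0 : 0 < C0) (m_gt1 : 1 < m) (alpha2_gt0 : 0 < alpha2).
Hypotheses (d_gt0 : 0 < d) (mu_gt0 : 0 < mu).
Implicit Types (x y : 'cV[R]_n) (e t : R).

Hypothesis F_le : forall x, F_of W C0 m x <= alpha2 * weighted_sum m d mu x.

Let m_gt0 : 0 < m. Proof. exact: lt_trans ltr01 m_gt1. Qed.
Let m1_gt0 : 0 < m - 1. Proof. by rewrite subr_gt0. Qed.
Let c := (m * C0) `^ (1 / (m - 1)).
Let q := m / (m - 1).
Let c_gt0 : 0 < c. Proof. by apply: powR_gt0; exact: mulr_gt0. Qed.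
Let q_gt0 : 0 < q. Proof. exact: divr_gt0. Qed.

Lemma derive_chain_field_ge x v :
  - (c * F_of W C0 m x) - `|v| `^ q / q <= c * 'D_(chain_field x v) W x.
Proof.
rewrite (derive_chain_field C0 m)// -/(F_split W C0 m x x).
have -> : F_split W C0 m x x = F_of W C0 m x by [].
have := young_scaled ('D_e_last W x) v C0_gt0 m_gt1; rewrite /= -/c -/q.
by rewrite (mulrC v); lra.
Qed.

(* Dilating a polynomial steering of [x] to the origin in unit time costs at
   most a multiple of [e `^ d] during the time [e `^ mu]. *)
Lemma steering x e (P : 'I_n -> {poly R}) (M : R) : 0 < e -> 0 <= M ->
  (forall k (j : nat), (j < n)%N -> (P k)^`(j).[0] = (j == k)%:R /\ (P k)^`(j).[1] = 0) ->
  (forall k (j : 'I_n.+1) s, 0 <= s <= 1 -> `|(P k)^`(j).[s]| <= M) ->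
  (forall k, `|x k 0| <= e `^ weight d m mu k) ->
  exists (y : R -> 'cV[R]_n) (v : R -> R),
  [/\ y 0 = x, y (e `^ mu) = 0,
      forall t, is_derive t 1 y (chain_field (y t) (v t)),
      forall t i, 0 <= t <= e `^ mu -> `|y t i 0| <= n%:R * M * e `^ weight d m mu i &
      forall t, 0 <= t <= e `^ mu -> `|v t| <= n%:R * M * e `^ (d * (m - 1) / m)].
Proof.
move=> e0 M0 PE PM xe.
pose tau := e `^ mu; have tau0 : 0 < tau by exact: powR_gt0.
(* [Y j] is the j-th time derivative of [Y 0], a sum of rescaled Hermite polynomials. Along the
   chain, coordinate i is [Y i] and the control is [Y n]. *)
pose Y (j : nat) (t : R) :=
  \sum_(k < n) (x k 0 * tau ^+ k / tau ^+ j) * (P k)^`(j).[tau^-1 * t].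
have dY j t : is_derive t 1 (Y j) (Y j.+1 t).
  rewrite (_ : Y j = \sum_(k < n) (fun t => (x k 0 * tau ^+ k / tau ^+ j) * (P k)^`(j).[tau^-1 * t])); last first.
    by apply/funext => s; rewrite fct_sumE.
  apply: is_derive_sum => k.
  have H : is_derive t 1 (fun s => (P k)^`(j).[tau^-1 * s]) (tau^-1 * (P k)^`(j.+1).[tau^-1 * t]).
    have d1 : is_derive t (1 : R) (fun s => tau^-1 * s) tau^-1.
      have := is_deriveZ tau^-1 (is_derive_id t (1 : R)); rewrite [_ *: 1]mulr1; exact.
    have := is_derive1_comp (is_derive_poly ((P k)^`(j)) (tau^-1 * t)) d1.
    by rewrite -derivnS mulrC; exact.
  have := is_deriveZ (x k 0 * tau ^+ k / tau ^+ j) H.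
  rewrite [_ *: (_ * _)]mulrA (_ : _ / _ * tau^-1 = x k 0 * tau ^+ k / tau ^+ j.+1); first exact.
  by rewrite exprSr invfM -!mulrA; congr (_ * (_ * _)); rewrite mulrC.
(* Since the weights form an arithmetic progression of step mu, r_k + k mu - j mu does not depend on
   k: all terms of [Y j] have the same order. For j = n it is the input weight. *)
have Yb j t : (j <= n)%N -> 0 <= t <= tau ->
    `|Y j t| <= n%:R * M * e `^ (d * (m - 1) / m + (n - j)%:R * mu).
  move=> jn /andP[t0 ttau].
  have s01 : 0 <= tau^-1 * t <= 1.
    by rewrite mulr_ge0 ?invr_ge0 ?(ltW tau0)//= mulrC ler_pdivrMr// mul1r.
  rewrite (le_trans (ler_norm_sum _ _ _))// -mulrA -[n in n%:R]card_ord mulr_natl -sumr_const.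
  apply: ler_sum => k _; rewrite normrM mulrC.
  have jn' : (j < n.+1)%N by [].
  have /= := PM k (Ordinal jn') _ s01 => HP.
  apply: ler_pM => //.
  rewrite !normrM normfV !normrX (gtr0_norm tau0).
  apply: (@le_trans _ _ (e `^ weight d m mu k * tau ^+ k / tau ^+ j)).
    by rewrite !ler_wpM2r ?invr_ge0 ?exprn_ge0 ?(ltW tau0).
  rewrite /tau -!powR_mulrn ?powR_ge0// -!powRrM -powRD ?(gt_eqF e0) ?implybT//.
  rewrite -powRN -powRD ?(gt_eqF e0) ?implybT// le_eqVlt; apply/orP; left; apply/eqP.
  congr (_ `^ _); rewrite /weight !natrB ?(ltnW (ltn_ord k))//; ring.
exists (fun t => \col_i Y i t), (Y n); split.
- apply/colP => i; rewrite mxE /Y (bigD1 i)//= big1 => [|k ki].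
    by rewrite mulr0 (PE i i (ltn_ord i)).1 eqxx mulr1 addr0 mulfK// expf_neq0// gt_eqF.
  by rewrite mulr0 (PE k i (ltn_ord i)).1 eq_sym [_ == _](negbTE ki) mulr0.
- apply/colP => i; rewrite !mxE /Y big1 => // k _.
  by rewrite mulVf ?gt_eqF// (PE k i (ltn_ord i)).2 mulr0.
- move=> t; apply/is_derive_cVP => i.
  rewrite (_ : (fun s => _) = Y i); last by apply/funext => s; rewrite mxE.
  rewrite (_ : chain_field _ _ i 0 = Y i.+1 t); first exact: dY.
  rewrite /chain_field mxE.
  have [iN|iN] := eqVneq i.+1 n.
    by rewrite jordan0_last// !mxE iN eqxx mulr1 add0r.
  have i1 : (i.+1 < n)%N by rewrite ltn_neqAle iN ltn_ord.
  by rewrite (@jordan0_coord _ _ _ i (Ordinal i1))// !mxE (negbTE iN) mulr0 addr0.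
- by move=> t i ht; rewrite mxE; apply: Yb => //; exact: ltnW.
- by move=> t ht; have := Yb n t (leqnn n) ht; rewrite subnn mul0r addr0.
Qed.

(** With e^d equal to the weighted sum S, the bound e^(d + mu) of the steering cost reads S^(1 + mu
    / d). *)
Lemma W_upper : exists2 K : R, 0 < K &
  forall x, W x <= K * weighted_sum m d mu x `^ (1 + mu / d).
Proof.
have [P PE] := @steering_poly R n.
have [M M0 PM] := horner_bounded_family (fun k (j : 'I_n.+1) => (P k)^`(j)).
pose N := n%:R * M.
(* Bounds c F_W + |v|^q / q in units of e^d, given |y_i| <= N e^(r_i) and |v| <= N e^(d / q). *)
pose K := c * alpha2 * (\sum_(i < n) N `^ (d / weight d m mu i)) + N `^ q / q.
have N0 : 0 <= N by exact: mulr_ge0.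
have K0 : 0 <= K.
  apply: addr_ge0; last by rewrite divr_ge0 ?powR_ge0 ?(ltW q_gt0).
  apply: mulr_ge0; first by rewrite mulr_ge0 ?(ltW c_gt0) ?(ltW alpha2_gt0).
  by apply: sumr_ge0 => i _; exact: powR_ge0.
(* The [+ 1] secures strict positivity, as [decay_rate] divides by a power of this constant. *)
exists (K / c + 1); first by rewrite ltr_wpDl// divr_ge0// ltW.
move=> x; set S := weighted_sum m d mu x.
have [->|x0] := eqVneq x 0.
  by rewrite W_pos.1 mulr_ge0 ?powR_ge0// addr_ge0// divr_ge0// ltW.
have Sx i : `|x i 0| `^ (d / weight d m mu i) <= S.
  rewrite /S /weighted_sum (bigD1 i)//= lerDl; apply: sumr_ge0 => j _.
  exact: powR_ge0.
have S0 : 0 < S.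
  have [i xi] : exists i, x i 0 != 0.
    apply/existsP; rewrite -negb_forall; apply: contra x0 => /forallP xi0.
    by apply/eqP/colP => i; rewrite mxE; exact/eqP.
  by apply: lt_le_trans (Sx i); apply: powR_gt0; rewrite normr_gt0.
(* With e^d = S, the inequality |x_i|^(d / r_i) <= S becomes |x_i| <= e^(r_i). *)
pose e := S `^ d^-1; have e0 : 0 < e by exact: powR_gt0.
have xe i : `|x i 0| <= e `^ weight d m mu i.
  have r0 := weight_gt0 m_gt1 d_gt0 mu_gt0 i.
  rewrite /e -powRrM -[leLHS](powRr1)// (_ : 1 = d / weight d m mu i * (d^-1 * weight d m mu i)); last first.
    by field; rewrite !gt_eqF.
  rewrite powRrM ge0_ler_powR ?nnegrE ?powR_ge0 ?(ltW S0)//.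
  by rewrite mulr_ge0 ?invr_ge0 ?(ltW r0) ?(ltW d_gt0).
have [y [v [y0 ytau dy yb vb]]] := steering e0 M0 PE PM xe.
set tau := e `^ mu in ytau yb vb.
have tau0 : 0 < tau by exact: powR_gt0.
suff : c * W x <= K * e `^ d * tau.
  rewrite -ler_pdivlMl// => /le_trans; apply.
  rewrite /tau /e -!powRrM (_ : d^-1 * d = 1) ?mulVf ?gt_eqF// -mulrA -powRD ?(gt_eqF S0) ?implybT//.
  by rewrite mulrA (mulrC d^-1) ler_wpM2r ?powR_ge0// (mulrC _ K) lerDl.
pose g (t : R) := - (c * W (y t)) - K * e `^ d * t.
suff : g tau <= g 0 by rewrite /g ytau y0 W_pos.1; lra.
have dg t : is_derive t 1 g (- (c * 'D_(chain_field (y t) (v t)) W (y t)) - K * e `^ d).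
  have dWy := is_derive_C1_comp W_C1 (dy t).
  rewrite (_ : g = - (c \*: (W \o y)) - (K * e `^ d) \*: id)//.
  by apply: is_derive_eq; rewrite [_%:A]mulr1.
apply: (derive_le0_le (ltW tau0) _ (fun t _ _ => dg t)) => [|t t0 ttau].
  apply: continuous_subspaceT => t; apply/differentiable_continuous/derivable1_diffP.
  exact: (dg t).(ex_derive).
have tt : 0 <= t <= tau by rewrite !ltW.
rewrite subr_le0 -lerN2 opprK; apply: le_trans (derive_chain_field_ge (y t) (v t)).
rewrite -opprD lerN2 /K mulrDl lerD//.
  rewrite -!mulrA ler_pM2l//; apply: le_trans (F_le _) _; rewrite ler_pM2l// mulr_suml.
  apply: ler_sum => i _; have r0 := weight_gt0 m_gt1 d_gt0 mu_gt0 i.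
  have -> : e `^ d = (e `^ weight d m mu i) `^ (d / weight d m mu i).
    by rewrite -powRrM mulrC divfK// gt_eqF.
  rewrite -powRM ?powR_ge0// ge0_ler_powR ?nnegrE ?mulr_ge0 ?powR_ge0//.
  - exact: ltW.
  - by rewrite invr_ge0 ltW.
  - exact: yb.
rewrite mulrAC ler_pM2r ?invr_gt0//.
have -> : e `^ d = (e `^ (d * (m - 1) / m)) `^ q.
  by rewrite -powRrM; congr (_ `^ _); rewrite /q; field; rewrite !gt_eqF.
rewrite -powRM ?powR_ge0// ge0_ler_powR ?nnegrE ?(ltW q_gt0) ?mulr_ge0 ?powR_ge0//.
exact: vb.
Qed.

End UpperBound.

(** * Finite-time convergence *)

Section GluingSolutions.
Context {R : realType} {n : nat}.
Implicit Types (x y z g dg : R -> 'cV[R]_n) (f : 'cV[R]_n -> 'cV[R]_n).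

(** The mean value theorem coordinate by coordinate; with the sup norm no constant is lost. *)
Lemma derive_norm_le_cV g dg (a b L : R) : a <= b -> 0 <= L ->
  {within `[a, b], continuous g} ->
  (forall t, a < t -> t < b -> is_derive t 1 g (dg t)) ->
  (forall t, a < t -> t < b -> `|dg t| <= L) -> `|g b - g a| <= L * (b - a).
Proof.
move=> ab L0 cg dgE dgL; apply: norm_cV_le => [|i].
  by rewrite mulr_ge0// subr_ge0.
rewrite !mxE; apply: (@derive_norm_le _ (fun t => g t i 0) (fun t => dg t i 0)) => //.
- move=> t; apply: (continuous_comp (g := fun y : 'cV_n => y i 0) (cg t)).
  exact: coord_continuous.
- by move=> t ta tb; apply: (is_derive_cVP _ _ _).1; exact: dgE.
- by move=> t ta tb; apply: le_trans (norm_cV_ge _ _) (dgL t ta tb).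
Qed.

Lemma lipschitz_within_continuous {V : normedModType R} (A : set R) (g : R -> V) (L : R) :
  0 <= L -> (forall s t, A s -> A t -> s <= t -> `|g t - g s| <= L * (t - s)) ->
  {within A, continuous g}.
Proof.
move=> L0 gL; apply/subspace_continuousP => s As; apply/cvgrPdist_le => e e0.
have L1 : 0 < L + 1 by rewrite ltr_wpDl.
rewrite near_withinE; near=> t => At.
have : `|g s - g t| <= L * `|s - t|.
  have [st|/ltW st] := leP s t.
    by rewrite distrC (distrC s) [X in _ * X]ger0_norm ?subr_ge0// gL.
  by rewrite [X in _ * X]ger0_norm ?subr_ge0// gL.
move=> /le_trans; apply; apply: (@le_trans _ _ ((L + 1) * `|s - t|)).
  by rewrite ler_wpM2r// lerDl.
rewrite -ler_pdivlMl// mulrC; near: t; apply: cvgr_dist_le => //; exact: divr_gt0.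
Unshelve. all: by end_near. Qed.

Lemma is_derive_scalel {V : normedModType R} (v : V) (t : R) :
  is_derive t 1 (fun s : R => s *: v) v.
Proof.
apply: is_derive_littleo => e e0; exists 1 => // s _.
by rewrite -!scalerBl subrr scale0r normr0 mulr_ge0// ltW.
Qed.

(** Near [r] the function z(t) - t f(z(r)) has a small derivative on either side, because f(z(t)) is
    continuous at [r]. *)
Lemma is_derive_removable f z (a r b : R) : continuous f -> a < r -> r < b ->
  {within `[a, b], continuous z} ->
  (forall t, a < t -> t < b -> t != r -> is_derive t 1 z (f (z t))) ->
  is_derive r 1 z (f (z r)).
Proof.
move=> cf ar rb cz dz; apply: is_derive_littleo => e e0.
have zr : z t @[t --> r] --> z r.
  have : {in `]a, b[%classic, continuous z}.
    rewrite -continuous_open_subspace//.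
    by apply: continuous_subspaceW cz; exact: subset_itv_oo_cc.
  by apply; rewrite inE/= in_itv/= ar.
have fzr : f (z t) @[t --> r] --> f (z r) by apply: continuous_cvg zr; exact: cf.
have /cvgrPdist_le/(_ e e0)/nbhs_ballP[d /= d0 Hd] := fzr.
exists (Num.min d (Num.min (r - a) (b - r))); first by rewrite !lt_min d0 !subr_gt0 ar.
(* Only intervals with [r] as an endpoint, so that the mean value theorem never evaluates the
   derivative at [r]. *)
have main (s t : R) : a <= s -> s <= t -> t <= b -> (s = r \/ t = r) -> t - s < d ->
    `|z t - z s - (t - s) *: f (z r)| <= e * (t - s).
  move=> as_ st tb sr td.
  have -> : z t - z s - (t - s) *: f (z r) = (z t - t *: f (z r)) - (z s - s *: f (z r)).
    by rewrite scalerBl !opprB addrACA [RHS]addrACA (addrC (- z s)).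
  apply: (@derive_norm_le_cV (fun t => z t - t *: f (z r)) (fun t => f (z t) - f (z r))) => //.
  - exact: ltW.
  - have czst : {within `[s, t], continuous z}.
      by apply: continuous_subspaceW cz; apply: subset_itvScc; rewrite bnd_simp.
    have cl : {within `[s, t], continuous (fun w => w *: f (z r))}.
      by apply: continuous_subspaceT => w; exact: scalel_continuous.
    by move=> w; exact: cvgB (czst w) (cl w).
  - move=> w sw wt; apply: is_deriveB.
      apply: dz; [exact: le_lt_trans sw|exact: lt_le_trans tb|].
      by case: sr => <-; rewrite ?(gt_eqF sw)// ?(lt_eqF wt).
    exact: is_derive_scalel.
  - move=> w sw wt; rewrite distrC; apply: Hd; rewrite -ball_normE/= ltr_norml.
    by apply/andP; case: sr => ?; subst; split; lra.
move=> t; rewrite !lt_min => /and3P[td]; rewrite !ltr_norml => /andP[ta1 ta2] /andP[tb1 tb2].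
have [rt|/ltW tr] := leP r t.
  move: td; rewrite ger0_norm ?subr_ge0// => td.
  by apply: main => //; [exact: ltW|lra|left].
move: td; rewrite distrC ger0_norm ?subr_ge0// => td.
rewrite -normrN (_ : - _ = z r - z t - (r - t) *: f (z r)).
  by apply: main => //; [lra|exact: ltW|right].
by rewrite opprB [in LHS]opprB [LHS]addrC -scaleNr opprB.
Qed.

End GluingSolutions.

(** * Decay of W along closed loops of any gain at least C0 *)

Section FiniteTime.
Context {R : realType} {n : nat}.
Variables (W : 'cV[R]_n -> R) (C0 m alpha1 alpha2 d mu kap : R).
Hypotheses (W_C1 : cont_diff W) (W_pos : pos_def W).
Hypotheses (C0_gt0 : 0 < C0) (m_gt1 : 1 < m).
Hypotheses (alpha1_gt0 : 0 < alpha1) (alpha2_gt0 : 0 < alpha2).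
Hypotheses (d_gt0 : 0 < d) (mu_gt0 : 0 < mu) (mu_lt : mu < d / (m * n%:R)).
Hypothesis F_ge : forall x, alpha1 * weighted_sum m d mu x <= F_of W C0 m x.
Hypothesis F_le : forall x, F_of W C0 m x <= alpha2 * weighted_sum m d mu x.
Hypothesis kap_ge : C0 <= kap.
Implicit Types (x : R -> 'cV[R]_n).

Local Notation u := (feedback W m kap).
Local Notation field := (fun y => chain_field y (u y)).

(** Inverts [W_upper]: d / (d + mu) is the reciprocal of 1 + mu / d. *)
Lemma decay_rate : exists2 a : R, 0 < a &
  forall y, a * W y `^ (d / (d + mu)) <= F_of W C0 m y.
Proof.
have [K K0 WK] := W_upper W_C1 W_pos C0_gt0 m_gt1 alpha2_gt0 d_gt0 mu_gt0 F_le.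
have dmu : 0 < d + mu by exact: addr_gt0.
exists (alpha1 / K `^ (d / (d + mu))); first by rewrite divr_gt0// powR_gt0.
move=> y; apply: le_trans (F_ge y); rewrite -mulrA ler_pM2l// mulrC ler_pdivrMr ?powR_gt0//.
have S0 := weighted_sum_ge0 m d mu y.
have g0 : 0 <= d / (d + mu) by rewrite divr_ge0 ?ltW.
apply: le_trans (ge0_ler_powR g0 _ _ (WK y)) _; rewrite ?nnegrE.
- exact: W_ge0.
- by rewrite mulr_ge0 ?powR_ge0 ?ltW.
have E : (1 + mu / d) * (d / (d + mu)) = 1 by field; rewrite !gt_eqF.
by rewrite powRM ?powR_ge0 ?(ltW K0)// -powRrM E powRr1// mulrC.
Qed.

Lemma continuous_field : continuous field.
Proof. exact/continuous_chain_field/continuous_feedback. Qed.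

Lemma derive_W_le y : 'D_(field y) W y <= - F_of W C0 m y.
Proof.
by rewrite (derive_feedback C0)// gerDl oppr_le0 mulr_ge0 ?powR_ge0// subr_ge0.
Qed.

Lemma ode_solution_W_nincr x b s t : ode_solution field b x ->
  0 <= s -> s <= t -> t <= b -> W (x t) <= W (x s).
Proof.
move=> [cx dx] s0 st tb.
apply: (@derive_le0_le _ (W \o x) (fun r => 'D_(field (x r)) W (x r))) => //.
- have cst : {within `[s, t], continuous x}.
    by apply: continuous_subspaceW cx; apply: subset_itvScc; rewrite bnd_simp.
  by move=> r; apply: continuous_comp (cst r) _; exact: continuous_C1.
- move=> r sr rt; apply: is_derive_C1_comp => //.
  by apply: dx; [exact: le_lt_trans sr|exact: lt_le_trans tb].
- move=> r _ _; apply: le_trans (derive_W_le _) _; rewrite oppr_le0.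
  exact: F_of_ge0 F_ge _.
Qed.

(** As long as W > 0, the power W^s with s = mu / (d + mu) = 1 - d / (d + mu) decreases at least at
    the constant rate a s. *)
Lemma settling_time : exists2 rate : R, 0 < rate & forall x b, 0 <= b ->
  ode_solution field b x -> 0 < W (x b) -> rate * b <= W (x 0) `^ (mu / (d + mu)).
Proof.
have [a a0 aW] := decay_rate.
pose s := mu / (d + mu); have s0 : 0 < s by rewrite divr_gt0// addr_gt0.
exists (a * s); first exact: mulr_gt0.
move=> x b b0 xsol Wb.
have Wx t : 0 <= t -> t <= b -> 0 < W (x t).
  by move=> t0 tb; apply: lt_le_trans Wb _; exact: ode_solution_W_nincr xsol t0 tb (lexx b).
have [cx dx] := xsol.
(* The absolute value changes nothing since W >= 0, and gives access to [continuous_norm_powR]. *)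
pose g (t : R) := `|W (x t)| `^ s + a * s * t.
suff : g b <= g 0.
  rewrite /g mulr0 addr0 !ger0_norm ?W_ge0//; apply: le_trans.
  by rewrite lerDr powR_ge0.
have dg t : 0 < t -> t < b ->
    is_derive t 1 g (s * W (x t) `^ (s - 1) * 'D_(field (x t)) W (x t) + a * s).
  move=> t0 tb; have Wt := Wx t (ltW t0) (ltW tb).
  have dW := is_derive_C1_comp W_C1 (dx t t0 tb).
  have dp := is_derive1_comp (is_derive1_powR s Wt) dW.
  have dl : is_derive t (1 : R) (fun t => a * s * t) (a * s).
    have := is_deriveZ (a * s) (is_derive_id t (1 : R)); rewrite [_ *: 1]mulr1; exact.
  apply: near_eq_is_derive (is_deriveD dp dl).
  near=> r; rewrite /g !fctE /= ger0_norm ?W_ge0//.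
apply: (derive_le0_le b0 _ dg) => [|t t0 tb].
  have c1 : {within `[0, b], continuous (fun t => `|W (x t)| `^ s)}.
    move=> t; apply: (continuous_comp (g := fun y => `|W y| `^ s) (cx t)).
    apply: (continuous_comp (f := W) (g := fun r => `|r| `^ s)); first exact: continuous_C1.
    exact: continuous_norm_powR.
  have c2 : {within `[0, b], continuous (fun t => a * s * t)}.
    by apply: continuous_subspaceT => r; exact: mulrl_continuous.
  by move=> t; exact: cvgD (c1 t) (c2 t).
have Wt := Wx t (ltW t0) (ltW tb).
have H : 'D_(field (x t)) W (x t) <= - (a * W (x t) `^ (d / (d + mu))).
  by apply: le_trans (derive_W_le _) _; rewrite lerN2.
have E : W (x t) `^ (s - 1) * W (x t) `^ (d / (d + mu)) = 1.
  rewrite -powRD ?(gt_eqF Wt) ?implybT// (_ : _ + _ = 0) ?powRr0// /s.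
  by field; rewrite gt_eqF// addr_gt0.
have p0 : 0 <= s * W (x t) `^ (s - 1) by rewrite mulr_ge0 ?powR_ge0 ?ltW.
have := ler_wpM2l p0 H; set A := _ `^ (s - 1) in E *; set B := _ `^ _ in E *.
have -> : s * A * - (a * B) = - (a * s) * (A * B) by ring.
by rewrite E mulr1; lra.
Unshelve. all: by end_near. Qed.

(** At 0 the drift term of F_W vanishes, so F_W(0) <= 0 reads C0 |W_n(0)|^m <= 0. *)
Lemma field0 : field 0 = 0.
Proof.
suff D0 : 'D_e_last W 0 = 0.
  by rewrite /chain_field mulmx0 add0r /feedback D0 sgn_pow0 mulr0 scale0r.
have : F_of W C0 m 0 <= 0.
  apply: le_trans (F_le 0) _; rewrite /weighted_sum big1 ?mulr0// => i _.
  rewrite mxE normr0 powR0// gt_eqF// divr_gt0//.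
  exact: weight_gt0 m_gt1 d_gt0 mu_gt0 i.
rewrite /F_of mulmx0 mulmx0 mxE subr0 pmulr_rle0// => H.
have /powR_eq0_eq0/eqP : `|'D_e_last W 0| `^ m = 0.
  by apply/eqP; rewrite eq_le H powR_ge0.
by rewrite normr_eq0 => /eqP.
Qed.

Lemma W_eq0 y : W y <= 0 -> y = 0.
Proof.
by move=> Wy; apply/eqP; apply: contraTT Wy => /W_pos.2; rewrite -ltNge.
Qed.

Lemma ode_solution_exists (x0 : 'cV[R]_n) H :
  exists x B, [/\ continuous x, x 0 = x0, ode_solution field H x &
    forall t, 0 <= t -> t <= H -> `|x t| <= B].
Proof.
have [c c0 [c2 cW]] := W_coercive W_C1 W_pos C0_gt0 m_gt1 alpha1_gt0 d_gt0 mu_gt0 mu_lt F_ge.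
have [||x xsol] := @ode_exists _ _ field x0 ((c2 + W x0) / c) H.
- exact: continuous_field.
- move=> b x b0 _ xsol x00; rewrite ler_pdivlMr// mulrC (le_trans (cW _))// lerD2l -x00.
  exact: ode_solution_W_nincr xsol (lexx 0) b0 (lexx b).
- by exists x, ((c2 + W x0) / c).
Qed.

Lemma settled x b t rate : 0 < rate -> (forall x b, 0 <= b ->
    ode_solution field b x -> 0 < W (x b) -> rate * b <= W (x 0) `^ (mu / (d + mu))) ->
  ode_solution field b x -> W (x 0) `^ (mu / (d + mu)) / rate < t -> t <= b -> x t = 0.
Proof.
move=> rate0 Hrate xsol tb tb'; apply: W_eq0; rewrite leNgt; apply/negP => Wt.
have t0 : 0 <= t by apply: le_trans (ltW tb); rewrite divr_ge0 ?powR_ge0// ltW.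
have := Hrate x t t0 (ode_solutionW tb' xsol) Wt.
by rewrite leNgt (mulrC rate) -ltr_pdivrMr// tb.
Qed.

Lemma closed_loop_global (x0 : 'cV[R]_n) : exists x (t1 : R),
  [/\ continuous x, x 0 = x0, forall t : R, 0 < t -> is_derive t 1 x (field (x t)),
      0 < t1 & forall t, t1 <= t -> x t = 0].
Proof.
have [rate rate0 Hrate] := settling_time.
pose T0 := W x0 `^ (mu / (d + mu)) / rate.
have T00 : 0 <= T0 by rewrite divr_ge0 ?powR_ge0// ltW.
have [y [_ [cy y0 ysol _]]] := ode_solution_exists x0 (T0 + 2).
have yz t : T0 < t -> t <= T0 + 2 -> y t = 0.
  by move=> h1 h2; apply: (settled rate0 Hrate ysol) => //; rewrite y0.
(* On (T0, T0 + 2] the solution [y] is already 0. Switching midway leaves around every time a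
   neighbourhood on which [x] is [y] or the equilibrium 0. *)
pose x (t : R) := if t < T0 + 1 then y t else 0.
have xl t : t < T0 + 2 -> \forall s \near t, y s = x s.
  move=> tT; near=> s; rewrite /x; case: ltP => // hs; rewrite yz//.
    by rewrite (lt_le_trans _ hs)// ltrDl.
  by rewrite ltW//; near: s; exact: lt_nbhsl.
have xr t : T0 + 1 < t -> \forall s \near t, 0 = x s.
  move=> tT; near=> s; rewrite /x ltNge ltW//; near: s; exact: lt_nbhsr.
have split_t t : t < T0 + 2 \/ T0 + 1 < t.
  by have [?|?] := ltP t (T0 + 2); [left|right; lra].
exists x, (T0 + 1); split.
- move=> t; have [tT|tT] := split_t t.
    apply: (cvg_trans (near_eq_cvg (xl t tT))).
    by rewrite -(nbhs_singleton (xl t tT)); exact: cy.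
  apply: (cvg_trans (near_eq_cvg (xr t tT))).
  by rewrite -(nbhs_singleton (xr t tT)); exact: cvg_cst.
- by rewrite /x y0 ltr_wpDl.
- move=> t t0; have [tT|tT] := split_t t.
    apply: near_eq_is_derive (xl t tT) _.
    by rewrite -(nbhs_singleton (xl t tT)); exact: ysol.2.
  apply: near_eq_is_derive (xr t tT) _.
  rewrite -(nbhs_singleton (xr t tT)) field0; exact: is_derive_cst.
- by rewrite ltr_wpDl.
- by move=> t; rewrite leNgt /x => /negbTE ->.
Unshelve. all: by end_near. Qed.

End FiniteTime.

(** * Maximal solutions are global and reach the origin *)

Section MaximalSolutions.
Context {R : realType} {n : nat}.
Variables (W : 'cV[R]_n -> R) (C0 m alpha1 alpha2 d mu kap : R).
Hypotheses (W_C1 : cont_diff W) (W_pos : pos_def W).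
Hypotheses (C0_gt0 : 0 < C0) (m_gt1 : 1 < m).
Hypotheses (alpha1_gt0 : 0 < alpha1) (alpha2_gt0 : 0 < alpha2).
Hypotheses (d_gt0 : 0 < d) (mu_gt0 : 0 < mu) (mu_lt : mu < d / (m * n%:R)).
Hypothesis F_ge : forall x, alpha1 * weighted_sum m d mu x <= F_of W C0 m x.
Hypothesis F_le : forall x, F_of W C0 m x <= alpha2 * weighted_sum m d mu x.
Hypothesis kap_ge : C0 <= kap.
Implicit Types (x : R -> 'cV[R]_n).

Local Notation u := (feedback W m kap).
Local Notation field := (fun y => chain_field y (u y)).

Lemma feedback_solutionW (T : \bar R) x b : (b%:E < T)%E ->
  feedback_solution u T x -> ode_solution field b x.
Proof.
move=> bT [T0 cx dx]; split.
  apply: continuous_subspaceW cx => t /=; rewrite in_itv/= => /andP[t0 tb].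
  by split => //; apply: le_lt_trans bT; rewrite lee_fin.
by move=> t t0 tb; apply: dx => //; apply: lt_trans bT; rewrite lte_fin.
Qed.

(** On a bounded set the field is bounded, so [x] is Lipschitz and has a limit at [r], from which a
    new solution of duration 1 starts. *)
Lemma bounded_solution_extends x (r B : R) : 0 < r ->
  feedback_solution u r%:E x -> (forall t, 0 <= t -> t < r -> `|x t| <= B) ->
  exists z, feedback_solution u (r + 1)%:E z /\ forall t, t < r -> z t = x t.
Proof.
move=> r0 xsol xB.
have cf : continuous field := continuous_field W_C1 m_gt1.
have [_ cx dx] := xsol.
have xsolb b : b < r -> ode_solution field b x.
  by move=> br; apply: feedback_solutionW xsol; rewrite lte_fin.
have [L L0 fL] := bounded_image_ball B cf.
have xlip (s t : R) : 0 <= s -> s <= t -> t < r -> `|x t - x s| <= L * (t - s).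
  move=> s0 st tr.
  apply: (derive_norm_le_cV (dg := fun w => field (x w))) => //.
  - by apply: continuous_subspaceW (xsolb t tr).1; apply: subset_itvScc; rewrite bnd_simp.
  - move=> w sw wt; apply: dx; first exact: le_lt_trans sw.
    by rewrite lte_fin (lt_trans wt).
  - move=> w sw wt; apply: fL; apply: xB; first by rewrite (le_trans s0)// ltW.
    exact: lt_trans tr.
have [U [UU rU]] := ultraFilterLemma (at_left_proper_filter r).
(* [ultra_bounded_cvg] wants a bound at every index. Its limit along an ultrafilter finer than the
   left neighbourhoods of [r] is a genuine left limit, by the Lipschitz estimate [xl_lip]. *)
pose xx (t : R) := if (0 <= t) && (t < r) then x t else 0.
have xxB t : `|xx t| <= `|B| + 1.
  rewrite /xx; case: ifP => [/andP[t0 tr]|_]; last by rewrite normr0 addr_ge0.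
  by rewrite (le_trans (xB t t0 tr))// (le_trans (ler_norm _))// lerDl.
have [l xl] := ultra_bounded_cvg UU xxB.
have xl_lip (t : R) : 0 <= t -> t < r -> `|l - x t| <= L * (r - t).
  move=> t0 tr; apply/ler_addgt0Pr => e e0.
  near U => s.
  have ts : t <= s.
    near: s; apply: rU; apply: filterS (nbhs_left_gt tr) => w; exact: ltW.
  have sr : s < r by near: s; apply: rU; exact: nbhs_left_lt.
  have ls : `|l - xx s| < e by near: s; exact: ((cvgrPdist_lt _ _).1 xl).
  rewrite /xx sr (le_trans t0 ts)/= in ls.
  rewrite -(subrKA (x s)) (le_trans (ler_normD _ _))// addrC; apply: lerD; last exact: ltW.
  apply: (le_trans (xlip t s t0 ts sr)).
  by rewrite ler_wpM2l// lerD2r ltW.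
have [y [B' [cy y0 [_ dy] yB]]] := ode_solution_exists W_C1 W_pos C0_gt0 m_gt1 alpha1_gt0
  d_gt0 mu_gt0 mu_lt F_ge kap_ge l 1.
have [L' L'0 fL'] := bounded_image_ball B' cf.
have ylip (s t : R) : 0 <= s -> s <= t -> t <= 1 -> `|y t - y s| <= L' * (t - s).
  move=> s0 st t1.
  apply: (derive_norm_le_cV (dg := fun w => field (y w))) => //.
  - exact: continuous_subspaceT.
  - by move=> w sw wt; apply: dy; [exact: le_lt_trans sw|exact: lt_le_trans t1].
  - move=> w sw wt; apply: fL'; apply: yB; first by rewrite (le_trans s0)// ltW.
    by rewrite ltW// (lt_le_trans wt).
pose z (t : R) := if t < r then x t else y (t - r).
have zx t : t < r -> z t = x t by rewrite /z => ->.
have zy t : r <= t -> z t = y (t - r) by rewrite leNgt /z => /negbTE ->.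
have LL0 : 0 <= L + L' by exact: addr_ge0.
have zlip (s t : R) : 0 <= s -> t < r + 1 -> s <= t -> `|z t - z s| <= (L + L') * (t - s).
  move=> s0 tr st; have ts0 : 0 <= t - s by rewrite subr_ge0.
  have t1 : t - r <= 1 by lra.
  have [rs|sr] := leP r s.
    rewrite !zy ?(le_trans rs)//.
    apply: (le_trans (ylip (s - r) (t - r) _ _ t1)); rewrite ?subr_ge0 ?lerD2r//.
    by rewrite opprB addrA subrK ler_wpM2r// lerDr.
  have [tr'|rt] := ltP t r.
    rewrite !zx//; apply: (le_trans (xlip s t s0 st tr')).
    by rewrite ler_wpM2r// lerDl.
  rewrite (zx s)// (zy t)// -(subrKA l) (le_trans (ler_normD _ _))//.
  have tr0 : 0 <= t - r by rewrite subr_ge0.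
  have := ylip 0 (t - r) (lexx 0) tr0 t1; rewrite y0 subr0 => H1.
  have := xl_lip s s0 sr => H2.
  have := ler_wpM2l L0 rt; have := ler_wpM2l L'0 (ltW sr).
  by move: H1 H2; lra.
have dz_left (t : R) : 0 < t -> t < r -> is_derive t 1 z (field (z t)).
  move=> t0 tr; rewrite zx//; apply: near_eq_is_derive (dx t t0 _); last by rewrite lte_fin.
  by near=> s; rewrite zx//; near: s; exact: lt_nbhsl.
have dz_right (t : R) : r < t -> t < r + 1 -> is_derive t 1 z (field (z t)).
  move=> rt tr; have tr0 : 0 < t - r by rewrite subr_gt0.
  have tr1 : t - r < 1 by lra.
  have dyr : is_derive t 1 (fun s => y (s - r)) (field (y (t - r))).
    apply/is_derive_cVP => i.
    have dyi := (is_derive_cVP _ _ _).1 (dy _ tr0 tr1) i.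
    have dr : is_derive t (1 : R) (fun s => s - r) 1 by exact: is_derive_shift.
    have := @is_derive1_comp _ (fun s => y s i 0) (fun s => s - r) t _ _ dyi dr.
    by rewrite mulr1; exact.
  rewrite zy ?ltW//; apply: near_eq_is_derive dyr.
  by near=> s; rewrite zy// ltW//; near: s; exact: lt_nbhsr.
exists z; split => //; split.
- by rewrite lte_fin addr_gt0.
- apply: (lipschitz_within_continuous LL0) => s t [s0 _] [_]; rewrite lte_fin => tr st.
  exact: zlip.
- move=> t t0; rewrite lte_fin => tr.
  have [tr'|rt|->] := ltgtP t r; [exact: dz_left|exact: dz_right|].
  (* Any closed interval around the junction inside [0, r + 1) would do. *)
  apply: (@is_derive_removable _ _ field z 0 r (r + 2^-1)) => //.
  + by rewrite ltrDl.
  + apply: (lipschitz_within_continuous LL0) => s w; rewrite /= !in_itv/= => /andP[s0 _] /andP[_ wr] sw.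
    by apply: zlip => //; lra.
  + move=> s s0 sr; rewrite neq_lt => /orP[sr'|rs]; first exact: dz_left.
    by apply: dz_right => //; lra.
Unshelve. all: by end_near. Qed.

Lemma finite_time_feedback : finite_time_convergence u.
Proof.
split; first exact: continuous_feedback.
move=> T x [xsol xmax].
have [T0 cx dx] := xsol.
have xsolb b : (b%:E < T)%E -> ode_solution field b x.
  by move=> bT; exact: feedback_solutionW xsol.
have T_oo : T = +oo%E.
  case: T T0 xsol xmax cx dx xsolb => [r|//|//] r0 xsol xmax _ _ xsolb; exfalso.
  rewrite lte_fin in r0.
  have [c c0 [c2 cW]] := W_coercive W_C1 W_pos C0_gt0 m_gt1 alpha1_gt0 d_gt0 mu_gt0 mu_lt F_ge.
  have [|z [zsol zx]] := @bounded_solution_extends x r ((c2 + W (x 0)) / c) r0 xsol.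
    move=> t t0 tr; rewrite ler_pdivlMr// mulrC (le_trans (cW _))// lerD2l.
    have tr' : (t%:E < r%:E)%E by rewrite lte_fin.
    exact: (ode_solution_W_nincr W_C1 m_gt1 alpha1_gt0 F_ge kap_ge (xsolb t tr')).
  have /= := xmax _ _ zsol (fun t _ tr => zx t tr).
  by rewrite lee_fin; lra.
split => //.
have [rate rate0 Hrate] := settling_time W_C1 W_pos C0_gt0 m_gt1 alpha1_gt0 alpha2_gt0
  d_gt0 mu_gt0 F_ge F_le kap_ge.
(* The [+ 1] makes the inequality required by [settled] strict. *)
exists (W (x 0) `^ (mu / (d + mu)) / rate + 1).
  by rewrite addr_ge0// divr_ge0 ?powR_ge0// ltW.
move=> t t1.
have := @settled _ _ _ _ _ _ _ W_pos x t t rate rate0 Hrate _ _ (lexx t); apply.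
  by apply: xsolb; rewrite T_oo ltry.
by rewrite (lt_le_trans _ t1)// ltrDl.
Qed.

End MaximalSolutions.

(** * Optimal control *)

Section LocalDecrease.
Context {R : realType}.

(* A Cousin-type argument: the supremum of the points reached from [a] without
   increase is reached, and cannot be interior. *)
Lemma locally_decreasing_le (G : R -> R) (a b : R) : a <= b ->
  (forall c, a <= c -> c <= b -> exists2 e : R, 0 < e &
    forall s t, a <= s -> s <= c -> c <= t -> t <= b -> t - s < e -> G t <= G s) ->
  G b <= G a.
Proof.
move=> ab Gloc; pose S := [set t | a <= t <= b /\ G t <= G a].
have Sa : S a by rewrite /S/= lexx ab.
have Sb : ubound S b by move=> t [/andP[]].
have Ssup : has_sup S by split; [exists a|exists b].
have ac : a <= sup S by apply: sup_upper_bound.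
have cb : sup S <= b by apply: sup_le_ub => //; exists a.
have [e e0 He] := Gloc _ ac cb.
have Gc : G (sup S) <= G a.
  have [t [/andP[at_ tb] Gt] tc] := sup_adherent e0 Ssup.
  have tS : t <= sup S by apply: sup_upper_bound => //; rewrite /S/= at_ tb.
  by apply: le_trans Gt; apply: He => //; lra.
move: cb; rewrite le_eqVlt => /predU1P[<-//|cb].
pose t := Num.min b (sup S + e / 2).
have e20 : 0 < e / 2 by exact: divr_gt0.
have ct : sup S < t by rewrite lt_min cb ltrDl.
have tb : t <= b by rewrite ge_min lexx.
have te : t <= sup S + e / 2 by rewrite ge_min lexx orbT.
suff : S t by move=> /(sup_upper_bound Ssup); rewrite leNgt ct.
split; first by rewrite tb (le_trans ac)// ltW.
apply: le_trans Gc; apply: He => //; first exact: ltW.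
lra.
Qed.

End LocalDecrease.

(** * Controlled trajectories in integral form *)

Section Trajectories.
Context {R : realType} {n : nat}.
Local Notation leb := (@lebesgue_measure R).
Implicit Types (v : R -> R) (x : R -> 'cV[R]_n) (q s t T : R).

Lemma integrable_segment (f : R -> R) s T : 0 <= s ->
  leb.-integrable `[0, T] (EFin \o f) -> leb.-integrable `]s, T] (EFin \o f).
Proof.
move=> s0; apply: integrableS => //.
by move=> t /=; rewrite !in_itv/= => /andP[/ltW st ->]; rewrite (le_trans s0).
Qed.

Lemma Rintegral_derive (f g : R -> R) t : continuous f -> continuous g ->
  (forall s : R, 0 < s -> is_derive s 1 g (f s)) -> 0 <= t ->
  \int[leb]_(s in `[0, t]) f s = g t - g 0.
Proof.
move=> cf cg dg; rewrite le_eqVlt => /predU1P[<-|t0].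
  by rewrite set_itv1 Rintegral_set1 subrr.
rewrite /Rintegral (@continuous_FTC2 _ f g)//.
- exact: continuous_subspaceT.
- split.
  + by move=> s; rewrite in_itv/= => /andP[s0 _]; exact: (dg s s0).(ex_derive).
  + exact/cvg_at_right_filter/cg.
  + exact/cvg_at_left_filter/cg.
- move=> s; rewrite in_itv/= => /andP[s0 _]; rewrite derive1E.
  exact: (dg s s0).(derive_val).
Qed.

Lemma Lq_integrable q v T : 0 < q -> Lq_control q v ->
  leb.-integrable `[0, T] (fun t => (`|v t| `^ q)%:E).
Proof.
move=> q0 [mv iv].
have mvq : measurable_fun (`[0, +oo[ : set R) (fun t => `|v t| `^ q).
  by apply: (measurableT_comp (measurable_powR _)) => //; exact: measurableT_comp.
apply: (@integrableS _ _ _ leb `[0%R, +oo[%classic `[0, T]%classic _) => //.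
  by move=> t /=; rewrite !in_itv/= => /andP[->].
apply/integrableP; split; first exact/measurable_EFinP.
by under eq_integral do rewrite gee0_abs ?lee_fin ?powR_ge0//.
Qed.

Lemma Lq_control_integrable q v T : 1 <= q -> Lq_control q v ->
  leb.-integrable `[0, T] (EFin \o v).
Proof.
move=> q1 Lv.
have q0 : 0 < q by exact: lt_le_trans ltr01 q1.
have i1 : leb.-integrable `[0, T] (EFin \o cst (1 : R)).
  apply: continuous_compact_integrable; first exact: segment_compact.
  by apply: continuous_subspaceT => t; exact: cvg_cst.
apply: (@le_integrable _ _ _ leb `[0, T]%classic (measurable_itv _) (EFin \o v)
  ((EFin \o cst 1) \+ (fun t => (`|v t| `^ q)%:E))) => //.
- apply/measurable_EFinP; apply: measurable_funS Lv.1 => //.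
  by move=> t /=; rewrite !in_itv/= => /andP[->].
- move=> t _ /=; rewrite lee_fin [leRHS]ger0_norm ?addr_ge0 ?powR_ge0//.
  exact: le_add1_powR.
- by apply: integrableD => //; exact: Lq_integrable.
Qed.

Lemma trajectory_continuous (x0 : 'cV[R]_n) v x T : trajectory x0 v x ->
  {within `[0, T], continuous x}.
Proof.
move=> [cx _]; apply: continuous_subspaceW cx => t /=.
by rewrite !in_itv/= => /andP[->].
Qed.

Lemma integrable_chain_field (x0 : 'cV[R]_n) v x T i : leb.-integrable `[0, T] (EFin \o v) ->
  trajectory x0 v x ->
  leb.-integrable `[0, T] (fun t => (chain_field (x t) (v t) i 0)%:E).
Proof.
move=> iv tx.
have -> : (fun t => (chain_field (x t) (v t) i 0)%:E) =
    (EFin \o (fun t => (jordan0 *m x t) i 0)) \+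
    (fun t => (e_last i 0)%:E * (v t)%:E)%E.
  apply/funext => t /=; rewrite -EFinM -EFinD; congr EFin.
  by rewrite /chain_field [LHS]mxE [X in _ + X]mxE (mulrC (v t)).
apply: integrableD => //; last exact: integrableZl.
apply: continuous_compact_integrable; first exact: segment_compact.
have cxT : {within `[0, T], continuous x} by exact: trajectory_continuous tx.
move=> t; apply: (continuous_comp (g := fun y : 'cV_n => (jordan0 *m y) i 0) (cxT t)).
apply: (continuous_comp (f := fun y => jordan0 *m y) (g := fun y : 'cV_n => y i 0)).
  exact: continuous_mulmx.
exact: coord_continuous.
Qed.

Lemma integrable_linear_chain_field (x0 : 'cV[R]_n) v x T (p : 'I_n -> R) :
  leb.-integrable `[0, T] (EFin \o v) -> trajectory x0 v x ->
  leb.-integrable `[0, T]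
    (EFin \o (fun t => \sum_i p i * chain_field (x t) (v t) i 0)).
Proof.
move=> iv tx.
have -> : EFin \o (fun t => \sum_i p i * chain_field (x t) (v t) i 0) =
    (fun t => \sum_i ((p i)%:E * (chain_field (x t) (v t) i 0)%:E))%E.
  by apply/funext => t /=; rewrite -sumEFin.
apply: integrable_sum => // i _; apply: integrableZl => //.
exact: integrable_chain_field tx.
Qed.

(** [p] will be a multiple of a gradient at one fixed point; for a linear functional the integral
    form of the equation suffices. *)
Lemma trajectory_increment (x0 : 'cV[R]_n) v x s t (p : 'I_n -> R) : 0 <= s -> s <= t ->
  leb.-integrable `[0, t] (EFin \o v) -> trajectory x0 v x ->
  \sum_i p i * (x t i 0 - x s i 0) =
  \int[leb]_(r in `]s, t]) (\sum_i p i * chain_field (x r) (v r) i 0).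
Proof.
move=> s0 st iv tx.
have t0 := le_trans s0 st.
have ifi i := integrable_chain_field i iv tx.
have E i : x t i 0 - x s i 0 = \int[leb]_(r in `]s, t]) chain_field (x r) (v r) i 0.
  rewrite !tx.2// opprD addrACA subrr add0r.
  by rewrite (@Rintegral_itvB _ (fun r => chain_field (x r) (v r) i 0)) ?bnd_simp//; exact: ifi.
under eq_bigr do rewrite E.
rewrite [RHS]/Rintegral; under eq_integral do rewrite -sumEFin.
under eq_integral do under eq_bigr do rewrite EFinM.
rewrite integral_sum//; last first.
  by move=> i; apply: integrableZl => //; exact: integrable_segment (ifi i).
rewrite -sum_fine; last first.
  by move=> i _; apply: integrable_fin_num => //; apply: integrableZl => //; exact: integrable_segment (ifi i).
apply: eq_bigr => i _; rewrite integralZl//; last exact: integrable_segment (ifi i).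
by rewrite fineM//; apply: integrable_fin_num => //; exact: integrable_segment (ifi i).
Qed.

End Trajectories.

(** * Young's inequality integrated along controlled trajectories *)

Section CostLowerBound.
Context {R : realType} {n : nat}.
Local Notation leb := (@lebesgue_measure R).
Variables (W : 'cV[R]_n -> R) (C0 m : R).
Hypotheses (W_C1 : cont_diff W) (C0_gt0 : 0 < C0) (m_gt1 : 1 < m).
Hypothesis F_ge0 : forall x, 0 <= F_of W C0 m x.
Implicit Types (v : R -> R) (x : R -> 'cV[R]_n) (s t T : R).

Local Notation c := ((m * C0) `^ (1 / (m - 1))).
Local Notation q := (m / (m - 1)).

Definition running_cost v x t : R := `|v t| `^ q / q + c * F_of W C0 m (x t).

Let m_gt0 : 0 < m. Proof. exact: lt_trans ltr01 m_gt1. Qed.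

Lemma cost_weight_gt0 : 0 < c.
Proof. by apply: powR_gt0; exact: mulr_gt0. Qed.

Lemma conjugate_exp_gt1 : 1 < q.
Proof. by rewrite ltr_pdivlMr ?mul1r ?subr_gt0// ltrBlDr ltrDl. Qed.

Let q_gt0 : 0 < q. Proof. exact: lt_trans ltr01 conjugate_exp_gt1. Qed.

Lemma running_cost_ge0 v x t : 0 <= running_cost v x t.
Proof.
apply: addr_ge0; first by rewrite divr_ge0 ?powR_ge0// ltW.
by rewrite mulr_ge0 ?F_ge0// ltW// cost_weight_gt0.
Qed.

Lemma C1_mean_value (a b : 'cV[R]_n) : exists2 th : R, 0 <= th <= 1 &
  W b - W a = 'D_(b - a) W (a + th *: (b - a)).
Proof.
pose g (th : R) := a + th *: (b - a).
have dg (th : R) : is_derive th 1 g (b - a).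
  rewrite -[X in is_derive _ _ _ X]add0r.
  exact: (is_deriveD (is_derive_cst a th 1) (is_derive_scalel (b - a) th)).
have dWg (th : R) : is_derive th 1 (W \o g) ('D_(b - a) W (g th)) by exact: is_derive_C1_comp.
have [th] : exists2 th : R, th \in `[0, 1] & (W \o g) 1 - (W \o g) 0 = 'D_(b - a) W (g th) * (1 - 0).
  apply: MVT_segment => //.
  apply: continuous_subspaceT => th; apply/differentiable_continuous/derivable1_diffP.
  exact: (dWg th).(ex_derive).
rewrite in_itv/= => th01; rewrite /g/= subr0 mulr1 scale1r scale0r addr0 subrKC => E.
by exists th.
Qed.

Lemma derive_C1_sum (z y : 'cV[R]_n) :
  'D_y W z = \sum_i 'D_(delta_mx i 0) W z * y i 0.
Proof.
have dW := W_C1.1 z.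
rewrite deriveE// {1}[y]matrix_sum_delta raddf_sum/=; apply: eq_bigr => i _.
by rewrite big_ord1 linearZ/= mulrC deriveE.
Qed.

Lemma running_cost_integrable (x0 : 'cV[R]_n) v x T : Lq_control q v -> trajectory x0 v x ->
  leb.-integrable `[0, T] (EFin \o running_cost v x).
Proof.
move=> Lv tx.
have -> : EFin \o running_cost v x =
    (fun t => (q^-1)%:E * (`|v t| `^ q)%:E)%E \+ (EFin \o (fun t => c * F_of W C0 m (x t))).
  by apply/funext => t; rewrite /running_cost/= EFinD (mulrC _ q^-1).
apply: integrableD => //; first by apply: integrableZl => //; exact: Lq_integrable.
apply: continuous_compact_integrable; first exact: segment_compact.
have cxT : {within `[0, T], continuous x} by exact: trajectory_continuous tx.
move=> t; apply: (continuous_comp (g := fun y => c * F_of W C0 m y) (cxT t)).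
apply: (continuous_comp (f := F_of W C0 m) (g := fun b => c * b)).
  exact: continuous_F_of.
exact: mulrl_continuous.
Qed.

(* Applying Young's inequality with the gradient frozen at a mean-value point
   avoids a chain rule along a merely absolutely continuous trajectory. *)
Lemma running_cost_bound (x0 : 'cV[R]_n) v x T : Lq_control q v -> trajectory x0 v x -> 0 <= T ->
  c * W x0 <= c * W (x T) + \int[leb]_(t in `[0, T]) running_cost v x t.
Proof.
move=> Lv tx T0.
have iv t := Lq_control_integrable t (ltW conjugate_exp_gt1) Lv.
have il t := running_cost_integrable t Lv tx.
have x00 : x 0 = x0.
  apply/colP => i; rewrite tx.2// set_itv1 Rintegral_set1 addr0//.
have c0 := cost_weight_gt0.
have cxT : {within `[0, T], continuous x} by exact: trajectory_continuous tx.
apply/ler_addgt0Pr => eps eps0.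
pose e := eps / (T + 1).
have T1 : 0 < T + 1 by rewrite ltr_wpDl.
have e0 : 0 < e by rewrite divr_gt0.
pose psi t := \int[leb]_(r in `[0, t]) running_cost v x r.
(* The slack [e] per unit time, at most [eps] in total, pays for freezing the gradient. *)
pose G t := - (c * W (x t)) - psi t - e * t.
suff : G T <= G 0.
  rewrite /G x00 mulr0 subr0 {2}/psi set_itv1 Rintegral_set1 subr0.
  have : e * T <= eps by rewrite /e mulrAC ler_pdivrMr// ler_pM2l// lerDl.
  rewrite /psi; lra.
apply: locally_decreasing_le => // r r0 rT.
(* The difference vanishes at the diagonal point (x r, x r), so it is small nearby. *)
have [del del0 Hdel] : exists2 del : R, 0 < del & forall z y, `|x r - z| < del -> `|x r - y| < del ->
    c * (F_split W C0 m z y - F_of W C0 m y) <= e.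
  have cH : continuous (fun p => F_split W C0 m p.1 p.2 - F_of W C0 m p.2).
    move=> p; apply: cvgB; first exact: continuous_F_split.
    by apply: (continuous_comp (f := snd) (g := F_of W C0 m)); [exact: cvg_snd|exact: continuous_F_of].
  have ec : 0 < e / c by exact: divr_gt0.
  have /cvgrPdist_le/(_ _ ec)/nbhs_ballP[del /= del0 Hdel] := cH (x r, x r).
  exists del => // z y xz xy.
  have := Hdel (z, y); rewrite /ball/= /prod_ball/= -!ball_normE/= => /(_ (conj xz xy)).
  have -> : F_split W C0 m (x r) (x r) = F_of W C0 m (x r) by [].
  rewrite subrr sub0r normrN => /(le_trans (ler_norm _)).
  by rewrite ler_pdivlMr// mulrC.
have [d d0 Hd] : exists2 d : R, 0 < d & forall t, 0 <= t <= T -> `|r - t| < d -> `|x r - x t| < del.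
  have rin : `[0, T]%classic r by rewrite /= in_itv/= r0.
  have /subspace_continuousP/(_ r rin)/cvgrPdist_lt/(_ _ del0) := cxT.
  rewrite near_withinE => /nbhs_ballP[d /= d0 Hd]; exists d => // t tT rt.
  by apply: Hd; rewrite -?ball_normE//= in_itv.
exists d => // s t s0 sr rt tT tsd.
have st := le_trans sr rt.
have [th /andP[th0 th1] Exi] := C1_mean_value (x s) (x t).
set z := x s + th *: (x t - x s) in Exi.
have xs : `|x r - x s| < del.
  by apply: Hd; [rewrite s0 (le_trans st)|rewrite ger0_norm ?subr_ge0//; lra].
have xt : `|x r - x t| < del.
  by apply: Hd; [rewrite tT (le_trans s0)|rewrite ler0_norm ?subr_le0//; lra].
have xz : `|x r - z| < del.
  (* The mean-value point lies on the segment from [x s] to [x t], hence in the same ball by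
     convexity. *)
  have -> : x r - z = (1 - th) *: (x r - x s) + th *: (x r - x t).
    by rewrite /z; apply/colP => i; rewrite !mxE; ring.
  rewrite (le_lt_trans (ler_normD _ _))// !normrZ (ger0_norm th0) ger0_norm ?subr_ge0//.
  have [->|th0'] := eqVneq th 0; first by rewrite mul0r addr0 subr0 mul1r.
  have thp : 0 < th by rewrite lt_neqAle eq_sym th0'.
  have := ler_wpM2l (_ : 0 <= 1 - th) (ltW xs); rewrite subr_ge0 => /(_ th1).
  have : th * `|x r - x t| < th * del by rewrite ltr_pM2l.
  lra.
rewrite -subr_le0 /G.
have Wst : c * (W (x s) - W (x t)) =
    \int[leb]_(w in `]s, t]) (\sum_i (- c * 'D_(delta_mx i 0) W z) * chain_field (x w) (v w) i 0).
  rewrite -(trajectory_increment _ s0 st (iv t) tx) -(opprB (W (x t))) Exi derive_C1_sum mulrN mulr_sumr -sumrN.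
  by apply: eq_bigr => i _; rewrite !mxE; ring.
have psist : psi t - psi s = \int[leb]_(w in `]s, t]) running_cost v x w.
  by rewrite /psi Rintegral_itvB ?bnd_simp//; exact: il.
have ist := integrable_segment s0 (il t).
have ie : leb.-integrable `]s, t] (EFin \o cst e).
  apply: (integrable_segment s0); apply: continuous_compact_integrable; first exact: segment_compact.
  by apply: continuous_subspaceT => w; exact: cvg_cst.
suff : c * (W (x s) - W (x t)) <= psi t - psi s + e * (t - s) by lra.
have -> : e * (t - s) = \int[leb]_(w in `]s, t]) cst e w.
  rewrite Rintegral_cst//; have := @lebesgue_measure_itv R `]s, t]; rewrite /= lte_fin => ->.
  move: st; rewrite le_eqVlt => /predU1P[->|st]; first by rewrite ltxx subrr.
  by rewrite st -EFinB.
rewrite psist Wst -RintegralD//.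
apply: le_Rintegral => //.
- exact: integrable_segment s0 (integrable_linear_chain_field _ (iv t) tx).
- exact: (integrableD _ ist ie).
move=> w /=; rewrite in_itv/= => /andP[sw wt].
have xw : `|x r - x w| < del.
  apply: Hd; first by rewrite (le_trans s0 (ltW sw)) (le_trans wt).
  by rewrite ltr_norml; apply/andP; split; lra.
have -> : \sum_i - c * 'D_(delta_mx i 0) W z * chain_field (x w) (v w) i 0 =
    - c * 'D_(chain_field (x w) (v w)) W z.
  by rewrite derive_C1_sum mulr_sumr; apply: eq_bigr => i _; rewrite mulrA.
rewrite (derive_chain_field C0 m)//.
have := young_scaled ('D_e_last W z) (v w) C0_gt0 m_gt1; rewrite /= (mulrC _ (v w)).
have := Hdel z (x w) xz xw; rewrite /running_cost/=; lra.
Qed.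

End CostLowerBound.

(** * Strict midpoint convexity of |u|^q *)

Section PowerMidpoint.
Context {R : realType}.
Implicit Types a b s t q : R.

(** The mean value theorem on each half of [s, t], whose slopes compare strictly because the
    derivative is increasing. *)
Lemma powR_midpoint_lt q s t : 1 < q -> 0 <= s -> s < t ->
  ((s + t) / 2) `^ q < (s `^ q + t `^ q) / 2.
Proof.
move=> q1 s0 st; have q0 : 0 < q by exact: lt_trans ltr01 q1.
have q10 : 0 < q - 1 by rewrite subr_gt0.
pose g (x : R) := `|x| `^ q.
have gE x : 0 <= x -> g x = x `^ q by move=> x0; rewrite /g ger0_norm.
have dg (x : R) : 0 < x -> is_derive x 1 g (q * x `^ (q - 1)).
  move=> x0; apply: near_eq_is_derive (is_derive1_powR q x0).
  by near=> y; rewrite gE// ltW//; near: y; exact: lt_nbhsr.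
have cg (a b : R) : {within `[a, b], continuous g}.
  by apply: continuous_subspaceT => x; exact: continuous_norm_powR.
set k := (s + t) / 2.
have sk : s < k by rewrite /k; lra.
have kt : k < t by rewrite /k; lra.
have k0 : 0 <= k by rewrite ltW// (le_lt_trans s0).
have [x1 + E1] : exists2 x, x \in `]s, k[ & g k - g s = q * x `^ (q - 1) * (k - s).
  apply: MVT => // x; rewrite in_itv/= => /andP[sx _]; apply: dg; exact: le_lt_trans sx.
have [x2 + E2] : exists2 x, x \in `]k, t[ & g t - g k = q * x `^ (q - 1) * (t - k).
  apply: MVT => // x; rewrite in_itv/= => /andP[sx _]; apply: dg; exact: le_lt_trans sx.
rewrite !in_itv/= => /andP[kx2 x2t] /andP[sx1 x1k].
have x12 : x1 `^ (q - 1) < x2 `^ (q - 1).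
  rewrite gt0_ltr_powR ?nnegrE//; [exact/ltW/(le_lt_trans s0)|exact/ltW/(le_lt_trans k0)|].
  exact: lt_trans kx2.
have : q * x1 `^ (q - 1) * (k - s) < q * x2 `^ (q - 1) * (t - k).
  have -> : t - k = k - s by rewrite /k; lra.
  by rewrite ltr_pM2r ?subr_gt0// ltr_pM2l.
rewrite -E1 -E2 !gE//; [lra|exact/ltW/(le_lt_trans s0)].
Unshelve. all: by end_near. Qed.

(** If |a| and |b| differ, the triangle inequality reduces to nonnegative numbers; otherwise a = - b
    is nonzero and the midpoint is 0. *)
Lemma norm_powR_midpoint_lt q a b : 1 < q -> a != b ->
  `|(a + b) / 2| `^ q < (`|a| `^ q + `|b| `^ q) / 2.
Proof.
move=> q1 ab; have q0 : 0 < q by exact: lt_trans ltr01 q1.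
have [nab|nab] := eqVneq `|a| `|b|; last first.
  apply: (@le_lt_trans _ _ (((`|a| + `|b|) / 2) `^ q)).
    rewrite ge0_ler_powR ?nnegrE ?(ltW q0)//.
    by rewrite normrM (ger0_norm (_ : 0 <= 2^-1))// ler_pM2r// ler_normD.
  case: (ltgtP `|a| `|b|) nab => // h _; first exact: powR_midpoint_lt.
  by rewrite (addrC `|a|) (addrC (`|a| `^ q)); exact: powR_midpoint_lt.
have : a ^+ 2 = b ^+ 2 by rewrite -(real_normK (num_real a)) nab real_normK// num_real.
move/eqP; rewrite eqf_sqr (negbTE ab)/= => /eqP aNb.
have b0 : b != 0 by apply: contra ab => /eqP b0; rewrite aNb b0 oppr0.
rewrite aNb addNr mul0r normr0 powR0 ?gt_eqF// normrN.
by rewrite divr_gt0// addr_gt0// powR_gt0// normr_gt0.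
Qed.

Lemma norm_powR_midpoint_le q a b : 1 < q ->
  `|(a + b) / 2| `^ q <= (`|a| `^ q + `|b| `^ q) / 2.
Proof.
move=> q1; have [->|ab] := eqVneq a b; last by rewrite ltW// norm_powR_midpoint_lt.
have half (r : R) : (r + r) / 2 = r by lra.
by rewrite !half.
Qed.

Local Open Scope convex_scope.

Lemma convex_fun_midpoint {n : nat} (f : 'cV[R]_n -> R) (x y : 'cV[R]_n) : convex_fun f ->
  f (2^-1 *: (x + y)) <= (f x + f y) / 2.
Proof.
move=> cf.
have h0 : 0 <= 2^-1 :> R by [].
have h1 : 2^-1 <= 1 :> R by lra.
have := cf (Itv01 h0 h1) x y; rewrite !inE => /(_ I I).
have -> : (x : convex_lmodType 'cV[R]_n) <| Itv01 h0 h1 |> (y : convex_lmodType 'cV[R]_n) =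
    (2^-1 *: (x + y) : 'cV[R]_n).
  by rewrite scalerDr; congr (_ + _ *: _); rewrite /= /unstable.onem; lra.
move=> /le_trans; apply; rewrite convRE /= /unstable.onem; lra.
Qed.

End PowerMidpoint.

(** * The value function is c W *)

Section ClosedLoopCost.
Context {R : realType} {n : nat}.
Local Notation leb := (@lebesgue_measure R).
Variables (W : 'cV[R]_n -> R) (C0 m alpha1 alpha2 d mu : R).
Hypotheses (W_C1 : cont_diff W) (W_pos : pos_def W).
Hypotheses (C0_gt0 : 0 < C0) (m_gt1 : 1 < m).
Hypotheses (alpha1_gt0 : 0 < alpha1) (alpha2_gt0 : 0 < alpha2).
Hypotheses (d_gt0 : 0 < d) (mu_gt0 : 0 < mu) (mu_lt : mu < d / (m * n%:R)).
Hypothesis F_ge : forall x, alpha1 * weighted_sum m d mu x <= F_of W C0 m x.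
Hypothesis F_le : forall x, F_of W C0 m x <= alpha2 * weighted_sum m d mu x.
Implicit Types (v : R -> R) (x : R -> 'cV[R]_n) (s t T : R).

Local Notation c := ((m * C0) `^ (1 / (m - 1))).
Local Notation q := (m / (m - 1)).
Local Notation F := (fun y => c * F_of W C0 m y).
Local Notation ell := (running_cost W C0 m).
Local Notation u := (feedback W m (m * C0)).

Let F_ge0 y : 0 <= F_of W C0 m y. Proof. exact: F_of_ge0 alpha1_gt0 F_ge y. Qed.
Let m_gt0 : 0 < m. Proof. exact: lt_trans ltr01 m_gt1. Qed.
Let q1 : 1 < q. Proof. exact: conjugate_exp_gt1 m_gt1. Qed.
Let q0 : 0 < q. Proof. exact: lt_trans ltr01 q1. Qed.
Let c0 : 0 < c. Proof. exact: cost_weight_gt0 C0_gt0 m_gt1. Qed.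

Lemma measurable_running_cost (x0 : 'cV[R]_n) v x : Lq_control q v -> trajectory x0 v x ->
  measurable_fun (`[0, +oo[ : set R) (ell v x).
Proof.
move=> [mv _] [cx _]; apply: measurable_funD.
  apply: (measurable_funM (f := fun t => `|v t| `^ q)) => //.
  by apply: (measurableT_comp (measurable_powR _)) => //; exact: measurableT_comp.
apply: measurable_funM => //; apply: subspace_continuous_measurable_fun => //.
by move=> t; apply: continuous_comp (cx t) _; exact: continuous_F_of.
Qed.

(** A finite cost K < c W(x0) would, by [running_cost_bound], keep W(x(T)) above a positive [eta]
    for all T. Then [decay_rate] keeps the running cost above a positive [k], and the cost exceeds K
    in finite time. *)
Lemma cost_ge (x0 : 'cV[R]_n) v x : Lq_control q v -> trajectory x0 v x ->
  ((c * W x0)%:E <= cost q F v x)%E.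
Proof.
move=> Lv tx.
have ml := measurable_running_cost Lv tx.
have l0 t : 0 <= ell v x t by exact: running_cost_ge0.
have il T := running_cost_integrable C0 W_C1 m_gt1 T Lv tx.
have costT T : ((\int[leb]_(t in `[0, T]) ell v x t)%:E <= cost q F v x)%E.
  rewrite /Rintegral fineK; last by apply: integrable_fin_num => //; exact: il.
  apply: ge0_subset_integral => //.
  - exact/measurable_EFinP.
  - by move=> t _; rewrite lee_fin l0.
  - by move=> t /=; rewrite !in_itv/= => /andP[->].
have : (0 <= cost q F v x)%E by apply: integral_ge0 => t _; rewrite lee_fin; exact: l0.
case: (cost q F v x) costT => [K|_ _|_]; [|by rewrite leey|by rewrite leeNy_eq].
move=> costT _; rewrite lee_fin leNgt; apply/negP => KW.
have {}costT T : \int[leb]_(t in `[0, T]) ell v x t <= K by rewrite -lee_fin.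
pose eta := (c * W x0 - K) / c.
have eta0 : 0 < eta by rewrite divr_gt0// subr_gt0.
have Weta T : 0 <= T -> eta <= W (x T).
  move=> T0; rewrite ler_pdivrMr// [leRHS]mulrC.
  by rewrite lerBlDr (le_trans (running_cost_bound W_C1 C0_gt0 m_gt1 Lv tx T0))// lerD2l.
have [a a0 aW] := decay_rate W_C1 W_pos C0_gt0 m_gt1 alpha1_gt0 alpha2_gt0
  d_gt0 mu_gt0 F_ge F_le.
pose k := c * (a * eta `^ (d / (d + mu))).
have k0 : 0 < k by rewrite !mulr_gt0// powR_gt0.
have lk T : 0 <= T -> k <= ell v x T.
  move=> T0; rewrite /running_cost (le_trans (_ : k <= c * F_of W C0 m (x T)))//; last first.
    by rewrite lerDr divr_ge0 ?powR_ge0 ?ltW.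
  rewrite ler_pM2l// (le_trans _ (aW _))// ler_pM2l//.
  rewrite ge0_ler_powR ?nnegrE ?(ltW eta0) ?Weta//.
    by rewrite divr_ge0 ?ltW// addr_gt0.
  exact: le_trans (ltW eta0) (Weta _ T0).
have K0 : 0 <= K by apply: le_trans (costT 0); rewrite set_itv1 Rintegral_set1.
pose T := K / k + 1.
have T0 : 0 < T by rewrite ltr_wpDl// divr_ge0// ltW.
have : k * T <= K.
  apply: le_trans (costT T).
  have -> : k * T = \int[leb]_(t in `[0, T]) cst k t.
    rewrite Rintegral_cst//; have := @lebesgue_measure_itv R `[0, T]; rewrite /= lte_fin T0 => ->.
    by rewrite -EFinB subr0.
  apply: le_Rintegral => //.
  - apply: continuous_compact_integrable; first exact: segment_compact.
    by apply: continuous_subspaceT => t; exact: cvg_cst.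
  - by move=> t /=; rewrite in_itv/= => /andP[t0 _]; exact: lk.
by rewrite /T mulrDr mulrCA divff ?gt_eqF//; lra.
Qed.

(** In the equality case of Young the running cost is exactly - c dW/dt, and W(x(t)) is 0 after the
    settling time. *)
Lemma closed_loop_cost (x0 : 'cV[R]_n) : exists x,
  [/\ Lq_control q (u \o x), trajectory x0 (u \o x) x &
      cost q F (u \o x) x = (c * W x0)%:E].
Proof.
have kap : C0 <= m * C0 by rewrite ler_peMl// ltW.
have [x [t1 [cx x00 dx t10 xt1]]] := closed_loop_global W_C1 W_pos C0_gt0 m_gt1
  alpha1_gt0 alpha2_gt0 d_gt0 mu_gt0 mu_lt F_ge F_le kap x0.
have cu : continuous u by exact: continuous_feedback.
have cux : continuous (u \o x) by move=> t; apply: continuous_comp; [exact: cx|exact: cu].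
have cl : continuous (ell (u \o x) x).
  move=> t; rewrite /running_cost; apply: cvgD.
    apply: cvgMr_tmp; apply: (continuous_comp (f := u \o x) (g := fun b => `|b| `^ q)).
      exact: cux.
    exact: continuous_norm_powR.
  apply: cvgMl_tmp; apply: (continuous_comp (f := x) (g := F_of W C0 m)); first exact: cx.
  exact: continuous_F_of.
have lE t : ell (u \o x) x t = - (c * 'D_(chain_field (x t) (u (x t))) W (x t)).
  rewrite (derive_chain_field C0 m)// /running_cost/=.
  have := young_scaled_eq ('D_e_last W (x t)) C0_gt0 m_gt1.
  rewrite /= -/(u (x t)) (mulrC ('D_e_last W (x t))).
  have -> : F_split W C0 m (x t) (x t) = F_of W C0 m (x t) by [].
  lra.
have costE : cost q F (u \o x) x = (c * W x0)%:E.
  have dcW t : 0 < t -> is_derive t 1 (fun t => - (c * W (x t))) (ell (u \o x) x t).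
    move=> t0; rewrite lE.
    have dW := is_derive_C1_comp W_C1 (dx t t0).
    by apply: (is_deriveN (f := fun t => c * W (x t))); exact: is_deriveZ.
  have ccW : continuous (fun t => - (c * W (x t))).
    move=> t; apply: cvgN; apply: cvgMl_tmp.
    by apply: (continuous_comp (f := x) (g := W)); [exact: cx|exact: continuous_C1].
  rewrite /cost (@ge0_continuous_FTC2y _ (ell (u \o x) x) (fun t => - (c * W (x t))) 0 0).
  - by rewrite sub0e -EFinN opprK x00.
  - by move=> t _; exact: running_cost_ge0.
  - exact: continuous_subspaceT.
  - apply: (@cvg_trans _ (cst (0 : R) @ +oo%R)); last exact: cvg_cst.
    apply: near_eq_cvg; near=> t.
    have tt : t1 <= t by near: t; apply: nbhs_pinfty_ge; exact: num_real.
    by rewrite /= xt1// W_pos.1 mulr0 oppr0.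
  - by move=> t t0; exact: (dcW t t0).(ex_derive).
  - exact/cvg_at_right_filter/ccW.
  - move=> t; rewrite in_itv/= andbT => t0; rewrite derive1E.
    exact: (dcW t t0).(derive_val).
have mu_ : measurable_fun (`[0, +oo[ : set R) (u \o x).
  by apply: measurable_funTS; exact: continuous_measurable_fun.
exists x; split => //.
- split => //.
  (* |u|^q is at most q times the running cost, so finite cost puts the control in L^q. *)
  apply: (@le_lt_trans _ _ (q%:E * cost q F (u \o x) x)%E); last first.
    by rewrite costE -EFinM ltry.
  have ml : measurable_fun (`[0, +oo[ : set R) (fun t => (ell (u \o x) x t)%:E).
    by apply/measurable_EFinP/measurable_funTS; exact: continuous_measurable_fun.
  rewrite /cost -ge0_integralZl//; last 2 first.
  + by move=> t _; rewrite lee_fin; exact: running_cost_ge0.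
  + by rewrite lee_fin ltW.
  apply: ge0_le_integral => //.
  + apply/measurable_EFinP.
    by apply: (measurableT_comp (measurable_powR _)) => //; exact: measurableT_comp.
  + exact: measurable_funeM.
  + move=> t _; rewrite -EFinM lee_fin mulrDr mulrCA divff ?gt_eqF// mulr1.
    by rewrite lerDl; apply: mulr_ge0; [exact: ltW|rewrite mulr_ge0// ltW].
- split; first exact: continuous_subspaceT.
  move=> t i t0.
  have E : \int[leb]_(s in `[0, t]) chain_field (x s) (u (x s)) i 0 = x t i 0 - x 0 i 0.
    apply: (@Rintegral_derive _ _ (fun s => x s i 0)) => // s.
    - apply: (continuous_comp (f := x) (g := fun y => chain_field y (u y) i 0)).
        exact: cx.
      apply: (continuous_comp (f := fun y => chain_field y (u y)) (g := fun y : 'cV_n => y i 0)).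
        exact: continuous_chain_field.
      exact: coord_continuous.
    - apply: (continuous_comp (f := x) (g := fun y : 'cV_n => y i 0)).
        exact: cx.
      exact: coord_continuous.
    - by move=> s0; apply: (is_derive_cVP _ _ _).1; exact: dx.
  by transitivity (x0 i 0 + (x t i 0 - x 0 i 0)); [rewrite x00 subrKC|rewrite -E].
Unshelve. all: by end_near. Qed.

End ClosedLoopCost.

(** * Uniqueness of the optimal control and optimality of the feedback *)

Section Optimality.
Context {R : realType} {n : nat}.
Local Notation leb := (@lebesgue_measure R).
Variables (W : 'cV[R]_n -> R) (C0 m alpha1 alpha2 d mu : R).
Hypotheses (W_C1 : cont_diff W) (W_pos : pos_def W).
Hypotheses (C0_gt0 : 0 < C0) (m_gt1 : 1 < m).
Hypotheses (alpha1_gt0 : 0 < alpha1) (alpha2_gt0 : 0 < alpha2).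
Hypotheses (d_gt0 : 0 < d) (mu_gt0 : 0 < mu) (mu_lt : mu < d / (m * n%:R)).
Hypothesis F_ge : forall x, alpha1 * weighted_sum m d mu x <= F_of W C0 m x.
Hypothesis F_le : forall x, F_of W C0 m x <= alpha2 * weighted_sum m d mu x.
Hypothesis F_convex : convex_fun (F_of W C0 m).
Implicit Types (v w : R -> R) (x y : R -> 'cV[R]_n) (s t T : R).

Local Notation c := ((m * C0) `^ (1 / (m - 1))).
Local Notation q := (m / (m - 1)).
Local Notation F := (fun z => c * F_of W C0 m z).
Local Notation ell := (running_cost W C0 m).
Local Notation u := (feedback W m (m * C0)).

Let F_ge0 z : 0 <= F_of W C0 m z. Proof. exact: F_of_ge0 alpha1_gt0 F_ge z. Qed.
Let q1 : 1 < q. Proof. exact: conjugate_exp_gt1 m_gt1. Qed.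
Let q0 : 0 < q. Proof. exact: lt_trans ltr01 q1. Qed.
Let c0 : 0 < c. Proof. exact: cost_weight_gt0 C0_gt0 m_gt1. Qed.
Let l0 v x t : 0 <= ell v x t. Proof. exact: running_cost_ge0. Qed.

Lemma finite_cost_integrable (x0 : 'cV[R]_n) v x : Lq_control q v -> trajectory x0 v x ->
  (cost q F v x < +oo)%E -> leb.-integrable `[0, +oo[ (EFin \o ell v x).
Proof.
move=> Lv tx fin; apply/integrableP; split.
  by apply/measurable_EFinP; exact: measurable_running_cost Lv tx.
by under eq_integral do rewrite gee0_abs ?lee_fin ?l0//.
Qed.

Lemma midpoint_control v w : Lq_control q v -> Lq_control q w ->
  Lq_control q (fun t => (v t + w t) / 2).
Proof.
move=> [mv iv] [mw iw].
have mz : measurable_fun (`[0, +oo[ : set R) (fun t => (v t + w t) / 2).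
  by apply: measurable_funM => //; exact: measurable_funD.
have mp (g : R -> R) : measurable_fun (`[0, +oo[ : set R) g ->
    measurable_fun (`[0, +oo[ : set R) (fun t => (`|g t| `^ q)%:E).
  move=> mg; apply/measurable_EFinP.
  by apply: (measurableT_comp (measurable_powR _)) => //; exact: measurableT_comp.
split => //.
apply: (@le_lt_trans _ _ (\int[leb]_(t in `[0%R, +oo[) ((`|v t| `^ q)%:E + (`|w t| `^ q)%:E))%E).
  apply: ge0_le_integral => //.
  - exact: mp.
  - by apply: emeasurable_funD; exact: mp.
  - move=> t _; rewrite -EFinD lee_fin (le_trans (norm_powR_midpoint_le _ _ q1))//.
    by rewrite ler_pdivrMr// ler_peMr ?addr_ge0 ?powR_ge0// ler1n.
rewrite ge0_integralD//; [exact: lte_add_pinfty|exact: mp|exact: mp].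
Qed.

Lemma midpoint_trajectory (x0 : 'cV[R]_n) v w x y :
  Lq_control q v -> Lq_control q w -> trajectory x0 v x -> trajectory x0 w y ->
  trajectory x0 (fun t => (v t + w t) / 2) (fun t => 2^-1 *: (x t + y t)).
Proof.
move=> Lv Lw tx ty; split.
  move=> t; apply: cvgZl_tmp; apply: cvgD; [exact: (tx.1 t)|exact: (ty.1 t)].
move=> t i t0.
have iv := Lq_control_integrable t (ltW q1) Lv.
have iw := Lq_control_integrable t (ltW q1) Lw.
have ix := integrable_chain_field i iv tx.
have iy := integrable_chain_field i iw ty.
have -> : (2^-1 *: (x t + y t)) i 0 = 2^-1 * (x t i 0 + y t i 0) by rewrite !mxE.
rewrite tx.2// ty.2//.
have E : forall s, (jordan0 *m (2^-1 *: (x s + y s)) + ((v s + w s) / 2) *: e_last) i 0 =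
    2^-1 * (chain_field (x s) (v s) i 0 + chain_field (y s) (w s) i 0).
  move=> s; rewrite (_ : _ + _ = 2^-1 *: (chain_field (x s) (v s) + chain_field (y s) (w s))).
    by rewrite [LHS]mxE [X in _ * X]mxE.
  rewrite /chain_field [X in _ = _ *: X]addrACA -scalerDl [RHS]scalerDr scalerA (mulrC 2^-1).
  by rewrite -mulmxDr scalemxAr.
rewrite [X in _ = _ + X](_ : _ = \int[leb]_(s in `[0, t])
    (2^-1 * (chain_field (x s) (v s) i 0 + chain_field (y s) (w s) i 0))); last first.
  by apply: eq_Rintegral => s _; exact: E.
rewrite RintegralZl//; last exact: (integrableD _ ix iy).
rewrite RintegralD//; rewrite /chain_field; lra.
Qed.

Lemma optimal_control_unique (x0 : 'cV[R]_n) v w x y :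
  Lq_control q v -> trajectory x0 v x -> cost q F v x = (c * W x0)%:E ->
  Lq_control q w -> trajectory x0 w y -> cost q F w y = (c * W x0)%:E ->
  {ae leb, forall t, 0 <= t -> w t = v t}.
Proof.
move=> Lv tx cx Lw ty cy.
have ivx : leb.-integrable `[0, +oo[ (EFin \o ell v x).
  by apply: finite_cost_integrable tx _ => //; rewrite cx ltry.
have iwy : leb.-integrable `[0, +oo[ (EFin \o ell w y).
  by apply: finite_cost_integrable ty _ => //; rewrite cy ltry.
pose z t := (v t + w t) / 2; pose p t := 2^-1 *: (x t + y t).
have Lz : Lq_control q z by exact: midpoint_control.
have tz : trajectory x0 z p by exact: midpoint_trajectory.
have Fmid t : F_of W C0 m (p t) <= (F_of W C0 m (x t) + F_of W C0 m (y t)) / 2.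
  exact: convex_fun_midpoint.
have lmid t : ell z p t <= (ell v x t + ell w y t) / 2.
  have := ler_wpM2l (ltW c0) (Fmid t).
  have iq : 0 <= q^-1 by rewrite invr_ge0 ltW.
  have := ler_wpM2r iq (norm_powR_midpoint_le (v t) (w t) q1).
  by rewrite /running_cost /z; lra.
have lmid_eq t : ell z p t = (ell v x t + ell w y t) / 2 -> w t = v t.
  move=> E; apply/eqP; rewrite eq_sym; apply: contra_eqT E => vw; rewrite lt_eqF//.
  have := ler_wpM2l (ltW c0) (Fmid t).
  have iq : 0 < q^-1 by rewrite invr_gt0.
  have := norm_powR_midpoint_lt q1 vw; rewrite -(ltr_pM2r iq).
  by rewrite /running_cost /z; lra.
have iavg : leb.-integrable `[0, +oo[ (EFin \o (fun t => (ell v x t + ell w y t) / 2)).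
  have -> : EFin \o (fun t => (ell v x t + ell w y t) / 2) =
      (fun t => (2^-1)%:E * ((EFin \o ell v x) \+ (EFin \o ell w y)) t)%E.
    by apply/funext => t /=; rewrite -EFinD -EFinM mulrC.
  by apply: integrableZl => //; exact: integrableD.
have izp : leb.-integrable `[0, +oo[ (EFin \o ell z p).
  apply: (@le_integrable _ _ _ leb `[0%R, +oo[%classic (measurable_itv _) _ _ _ _ iavg).
    by apply/measurable_EFinP; exact: measurable_running_cost Lz tz.
  move=> t _ /=; rewrite lee_fin !ger0_norm//.
  by rewrite divr_ge0// addr_ge0.
(* The convexity gap at the midpoint of two optimal pairs. The average costs exactly c W(x0) and the
   midpoint at least that, so this nonnegative function has integral 0; where it vanishes, strict
   convexity forces w = v. *)
pose h t := (ell v x t + ell w y t) / 2 - ell z p t.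
have h0 t : 0 <= h t by rewrite subr_ge0.
have ih : leb.-integrable `[0, +oo[ (EFin \o h) by exact: (integrableB _ iavg izp).
have cz := cost_ge W_C1 W_pos C0_gt0 m_gt1 alpha1_gt0 alpha2_gt0 d_gt0 mu_gt0 F_ge F_le Lz tz.
have inth : (\int[leb]_(t in `[0%R, +oo[) (h t)%:E = 0)%E.
  apply/le_anti/andP; split; last by apply: integral_ge0 => t _; rewrite lee_fin.
  rewrite integralB_EFin//.
  rewrite leeBlDr ?add0e; last exact: integrable_fin_num izp.
  apply: le_trans cz.
  have -> : (\int[leb]_(t in `[0%R, +oo[) ((ell v x t + ell w y t) / 2)%:E =
     (2^-1)%:E * (cost q F v x + cost q F w y))%E.
    under eq_integral do rewrite mulrC EFinM EFinD.
    by rewrite integralZl// ?integralD//; exact: integrableD.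
  by rewrite cx cy -EFinD -EFinM lee_fin; lra.
have mh : measurable_fun (`[0, +oo[ : set R) (EFin \o h) by case/integrableP : ih.
have : ae_eq leb `[0%R, +oo[%classic (EFin \o h) (cst 0%E).
  apply/ae_eq_integral_abs => //.
  by under eq_integral do rewrite gee0_abs ?lee_fin ?h0//.
apply: filterS => t ht t0; apply: lmid_eq.
have [] : (h t)%:E = 0%:E by apply: ht; rewrite /= in_itv/= t0.
by rewrite /h => /eqP; rewrite subr_eq0 => /eqP ->.
Qed.

Lemma feedback_solves_OCP : solves_OCP q F u.
Proof.
move=> x0.
have [x [Lv tx cx]] := closed_loop_cost W_C1 W_pos C0_gt0 m_gt1
  alpha1_gt0 alpha2_gt0 d_gt0 mu_gt0 mu_lt F_ge F_le x0.
have cge w y := @cost_ge _ _ _ _ _ _ _ _ _ W_C1 W_pos C0_gt0 m_gt1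
  alpha1_gt0 alpha2_gt0 d_gt0 mu_gt0 F_ge F_le x0 w y.
exists (u \o x), x; split.
- by split => // w y Lw ty; rewrite cx; exact: cge.
- move=> w y [Lw ty opt].
  apply: (optimal_control_unique Lv tx cx Lw ty); apply/le_anti/andP; split.
    by rewrite -cx; exact: opt.
  exact: cge.
- exact: aeW.
Qed.

End Optimality.

Theorem proposition6p7 (R : realType) (n : nat) (n_ge1 : (1 <= n)%N)
  (W : 'cV[R]_n -> R) (W_C1 : cont_diff W) (W_pos : pos_def W)
  (C0 m : R) (C0_gt0 : 0 < C0) (m_gt1 : 1 < m)
  (F_pos : pos_def (F_of W C0 m))
  (alpha1 alpha2 d mu : R)
  (alpha1_gt0 : 0 < alpha1) (alpha2_gt0 : 0 < alpha2) (d_gt0 : 0 < d)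
  (mu_gt0 : 0 < mu) (mu_lt : mu < d / (m * n%:R))
  (F_bounds : forall x : 'cV[R]_n,
     alpha1 * (\sum_(i < n) `|x i 0| `^ (d / weight d m mu i)) <= F_of W C0 m x /\
     F_of W C0 m x <= alpha2 * (\sum_(i < n) `|x i 0| `^ (d / weight d m mu i))) :
  finite_time_convergence
    (fun x => - C0 * sgn_pow ('D_e_last W x) (m - 1)) /\
  (cont_diff (F_of W C0 m) -> convex_fun (F_of W C0 m) ->
   homogeneous (weight d m mu) d (F_of W C0 m) ->
   solves_OCP (m / (m - 1))
     (fun x => (m * C0) `^ (1 / (m - 1)) * F_of W C0 m x)
     (fun x => - (m * C0) * sgn_pow ('D_e_last W x) (m - 1)) /\
   finite_time_convergence
     (fun x => - (m * C0) * sgn_pow ('D_e_last W x) (m - 1))).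
Proof.
have F_ge x : alpha1 * weighted_sum m d mu x <= F_of W C0 m x by exact: (F_bounds x).1.
have F_le x : F_of W C0 m x <= alpha2 * weighted_sum m d mu x by exact: (F_bounds x).2.
have finite_time k : C0 <= k -> finite_time_convergence (feedback W m k).
  exact: finite_time_feedback W_C1 W_pos C0_gt0 m_gt1 alpha1_gt0 alpha2_gt0
    d_gt0 mu_gt0 mu_lt F_ge F_le.
split; first exact: finite_time.
move=> _ F_convex _; split; last by apply: finite_time; rewrite ler_peMl// ltW.
exact: feedback_solves_OCP W_C1 W_pos C0_gt0 m_gt1 alpha1_gt0 alpha2_gt0
  d_gt0 mu_gt0 mu_lt F_ge F_le F_convex.
Qed.
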